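(* Let $(V,\mathrm{d})$ be the domain complex of a closed Hilbert complex $(W,\mathrm{d})$ satisfying the compactness property, and let $(V_h,\mathrm{d})$ be a family of subcomplexes of $(V,\mathrm{d})$ parametrized by $h$ and admitting uniformly $W$-bounded cochain projections $\pi_h$. Let $F\colon V^k\to W^k$ be monotone and Lipschitz with respect to the $V$-norm, and let $f\in W^k$. Let $(\sigma,u,p)\in V^{k-1}\times V^k\times\mathfrak{H}^k$ be the solution of $$\begin{aligned}\langle\sigma,\tau\rangle-\langle u,\mathrm{d}\tau\rangle&=0&&\forall\tau\in V^{k-1},\\ \langle\mathrm{d}\sigma,v\rangle+\langle\mathrm{d}u,\mathrm{d}v\rangle+\langle p,v\rangle+\langle F(u+p),v\rangle&=\langle f,v\rangle&&\forall v\in V^k,\\ \langle u,q\rangle&=0&&\forall q\in\mathfrak{H}^k,\end{aligned}$$ and let $(\sigma_h,u_h,p_h)\in V_h^{k-1}\times V_h^k\times\mathfrak{H}_h^k$ be the solution of $$\begin{aligned}\langle\sigma_h,\tau\rangle-\langle u_h,\mathrm{d}\tau\rangle&=0&&\forall\tau\in V_h^{k-1},\\ \langle\mathrm{d}\sigma_h,v\rangle+\langle\mathrm{d}u_h,\mathrm{d}v\rangle+\langle p_h,v\rangle+\langle F(u_h+p_h),v\rangle&=\langle f,v\rangle&&\forall v\in V_h^k,\\ \langle u_h,q\rangle&=0&&\forall q\in\mathfrak{H}_h^k.\end{aligned}$$ Then for some constant $C$ independent of $h$ and $(\sigma,u,p)$, $$\|\mathrm{d}(\sigma-\sigma_h)\|\le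 C\bigl[E(\mathrm{d}\sigma)+E(u)+E(\mathrm{d}u)+E(p)+\eta E(\sigma)+\mu E(P_{\mathfrak{B}}u)\bigr],$$ $$\|\sigma-\sigma_h\|\le C\bigl[E(\sigma)+E(u)+E(\mathrm{d}u)+E(p)+(\eta+\delta+\mu)E(\mathrm{d}\sigma)+\mu E(P_{\mathfrak{B}}u)\bigr],$$ $$\|u-u_h\|_V+\|p-p_h\|\le C\bigl(E(u)+E(\mathrm{d}u)+E(p)+\eta[E(\sigma)+E(\mathrm{d}\sigma)]+(\delta+\mu)E(\mathrm{d}\sigma)+\mu E(P_{\mathfrak{B}}u)\bigr).$$
   Context: All Hilbert spaces are real. A Hilbert complex $(W,\mathrm{d})$ is a sequence of Hilbert spaces $W^k$ with closed, densely defined linear maps $\mathrm{d}^k\colon V^k\subset W^k\to V^{k+1}\subset W^{k+1}$ (possibly unbounded) such that $\mathrm{d}^k\circ\mathrm{d}^{k-1}=0$. It is closed if each image $\mathrm{d}^kV^k$ is closed in $W^{k+1}$. The inner product and norm of $W^k$ are written $\langle\cdot,\cdot\rangle$, $\|\cdot\|$. The domain complex $(V,\mathrm{d})$ consists of the domains $V^k$ with the graph inner product $\langle u,v\rangle_V=\langle u,v\rangle+\langle\mathrm{d}^ku,\mathrm{d}^kv\rangle$ and norm $\|\cdot\|_V$. The adjoint $\mathrm{d}^*_k=(\mathrm{d}^{k-1})^*$ has domain $V_k^*\subset W^k$ and maps into $W^{k-1}$. Degree indices on $\mathrm{d},\mathrm{d}^*$ are suppressed. The compactness property: for each $k$, $V^k\cap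 V_k^*$ is dense in $W^k$ and the inclusion $V^k\cap V_k^*\hookrightarrow W^k$ is compact (with the intersection norm of $V^k$ and $V_k^*$, the latter with the graph norm of $\mathrm{d}^*$). Put $\mathfrak{Z}^k=\ker\mathrm{d}^k$, $\mathfrak{B}^k=\mathrm{d}^{k-1}V^{k-1}$, $\mathfrak{H}^k=\mathfrak{Z}^k\cap\mathfrak{B}^{k\perp}$ (harmonic space); $P_{\mathfrak{B}}$, $P_{\mathfrak{H}}$ are the $W$-orthogonal projections onto $\mathfrak{B}^k$, $\mathfrak{H}^k$. A subcomplex $V_h\subset V$ consists of Hilbert subspaces $V_h^j\subset V^j$ (closed subspaces for the $V$-norm, in practice finite-dimensional) with $\mathrm{d}V_h^j\subset V_h^{j+1}$. A cochain projection $\pi_h\colon V\to V_h$ is a family of linear, surjective, idempotent maps $\pi_h^j\colon V^j\to V_h^j$ with $\mathrm{d}\pi_h^j=\pi_h^{j+1}\mathrm{d}$; uniformly $W$-bounded means bounded in the $W$-norm, uniformly in $h$ (so that $\pi_h^j$ extends continuously to $W^j$). The discrete harmonic space is $\mathfrak{H}_h^k=\{z\in V_h^k:\mathrm{d}z=0,\ z\perp\mathrm{d}V_h^{k-1}\}$. $K\colon W^j\to W^j$ denotes, in each degree $j$, the bounded linear solution operator $Kg=u$, where $(\sigma,u,p)\in V^{j-1}\times V^j\times\mathfrak{H}^j$ is the unique solution of the linear mixed problem $\langle\sigma,\tau\rangle-\langle u,\mathrm{d}\tau\rangle=0$ for all $\tau\in V^{j-1}$; $\langle\mathrm{d}\sigma,v\rangle+\langle\mathrm{d}u,\mathrm{d}v\rangle+\langle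 p,v\rangle=\langle g,v\rangle$ for all $v\in V^j$; $\langle u,q\rangle=0$ for all $q\in\mathfrak{H}^j$. Define $$\delta=\delta_h^k=\|(I-\pi_h)K\|_{\mathcal{L}(W^k,W^k)},\qquad\mu=\mu_h^k=\|(I-\pi_h)P_{\mathfrak{H}}\|_{\mathcal{L}(W^k,W^k)},$$ $$\eta=\eta_h^k=\max_{j=0,1}\bigl\{\|(I-\pi_h)\mathrm{d}K\|_{\mathcal{L}(W^{k-j},W^{k-j+1})},\ \|(I-\pi_h)\mathrm{d}^*K\|_{\mathcal{L}(W^{k+j},W^{k+j-1})}\bigr\}.$$ Best approximation in the $W$-norm is $E(w)=\inf_{v\in V_h^j}\|w-v\|$ for $w\in W^j$, where $j$ is the degree of $w$. $F\colon V^k\to W^k$ is monotone if $\langle Fu-Fv,u-v\rangle\ge0$ for all $u,v\in V^k$, and Lipschitz with respect to the $V$-norm if $\|Fu-Fv\|\le C_F\|u-v\|_V$ for all $u,v\in V^k$ and some constant $C_F$. Under these assumptions both mixed problems have unique solutions. *)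

(* Defs.v *)
From HB Require Import structures.
From mathcomp Require Import all_boot all_order all_algebra.
From mathcomp Require Import all_classical all_reals all_analysis.
Set Implicit Arguments.
Unset Strict Implicit.
Unset Printing Implicit Defensive.
Import Order.TTheory GRing.Theory Num.Theory.
Import numFieldNormedType.Exports.
Local Open Scope classical_set_scope.
Local Open Scope ring_scope.

HB.mixin Record isHilbert (R : realType) W of CompleteNormedModule R W := {
  inner : {dot W for (idfun : R -> R)} ;
  norm_inner : forall x : W, `|x| = Num.sqrt (inner x x) }.

#[short(type="hilbertType")]
HB.structure Definition Hilbert (R : realType) :=
  {W of isHilbert R W & CompleteNormedModule R W}.

Notation "<| x , y |>" := (inner x y)
  (at level 0, x at level 99, y at level 99, format "<| x ,  y |>") : ring_scope.

Section HilbertSpaces.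
Context {R : realType}.

Definition linear_subspace (W : hilbertType R) (A : set W) :=
  A 0 /\ forall (a : R) (x y : W), A x -> A y -> A (a *: x + y).

Definition linear_on (W W' : hilbertType R) (A : set W) (f : W -> W') :=
  forall (a : R) (x y : W), A x -> A y -> f (a *: x + y) = a *: f x + f y.

(* Meaningful when A is a closed subspace. *)
Definition orth_proj (W : hilbertType R) (A : set W) (x : W) : W :=
  xget 0 [set z | A z /\ forall y, A y -> <|x - z, y|> = 0].

(* Meaningful for bounded linear f; sup is 0 on unbounded sets. *)
Definition opnorm (W W' : hilbertType R) (f : W -> W') : R :=
  sup [set `|f x| | x in [set x | `|x| <= 1]].

(* The continuous extension to W of a map f defined on a dense subset A. *)
Definition dense_extension (W : hilbertType R) (A : set W) (f : W -> W) (x : W) : W :=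
  lim (f y @[y --> within A (nbhs x)]).

Definition best_approx (W : hilbertType R) (A : set W) (x : W) : R :=
  inf [set `|x - y| | y in A].

End HilbertSpaces.

(* The degrees range over the integers; a complex indexed by a smaller interval
   is completed by zero spaces. The differential carries both its source and its
   target degree, so that degrees such as k - 1 and k need no casts: d i j is the
   differential when j = i + 1 and is arbitrary otherwise. Its values outside
   the domain V i are irrelevant. *)
Unset Implicit Arguments.
Record hilbert_complex (R : realType) := HilbertComplex {
  W :> int -> hilbertType R ;
  V : forall i, set (W i) ;
  d : forall i j, W i -> W j ;
  V_subspace : forall i, linear_subspace (V i) ;
  V_dense : forall i, dense (V i) ;
  d_linear : forall i j, j = i + 1 -> linear_on (V i) (d i j) ;
  d_closed : forall i j, j = i + 1 ->
    closed [set xy : W i * W j | V i xy.1 /\ xy.2 = d i j xy.1] ;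
  d_dom : forall i j, j = i + 1 -> forall x, V i x -> V j (d i j x) ;
  d_d : forall i j l, j = i + 1 -> l = j + 1 ->
    forall x, V i x -> d j l (d i j x) = 0 }.

Set Implicit Arguments.

Arguments V {R} X i : rename.
Arguments d {R} X {i} j x : rename.

Section Complex.
Context {R : realType} (X : hilbert_complex R).

Definition bdry (j : int) : set (X j) := d X j @` V X (j - 1).
Arguments bdry j : clear implicits.

Definition closed_complex := forall j, closed (bdry j).

(* The adjoint of d i j, whose domain is Vstar i j; the space written V^*_j is
   Vstar (j - 1) j. *)
Definition is_dstar (i j : int) (w : X j) (z : X i) :=
  forall v : X i, V X i v -> <|d X j v, w|> = <|v, z|>.

Definition Vstar (i j : int) : set (X j) := [set w | exists z : X i, is_dstar w z].
Arguments Vstar i j : clear implicits.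

Definition dstar (i j : int) (w : X j) : X i := xget 0 [set z : X i | is_dstar w z].

Definition normV (j : int) (x : X j) : R :=
  Num.sqrt (`|x| ^+ 2 + `|d X (j + 1) x| ^+ 2).

Definition normVstar (j : int) (x : X j) : R :=
  Num.sqrt (`|x| ^+ 2 + `|dstar (j - 1) x| ^+ 2).

Definition normVVstar (j : int) (x : X j) : R :=
  Num.sqrt (normV x ^+ 2 + normVstar x ^+ 2).

Definition compactness_property := forall j : int,
  dense (V X j `&` Vstar (j - 1) j) /\
  forall M : R,
    precompact [set x : X j | [/\ V X j x, Vstar (j - 1) j x & normVVstar x <= M]].

(* For S = V X this is the space Z^j `&` (B^j)^perp of harmonic forms, and for a
   subcomplex S it is the space of discrete harmonic forms. *)
Definition harmonic (S : forall j, set (X j)) (j : int) : set (X j) :=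
  [set z | [/\ S j z, d X (j + 1) z = 0 &
               forall y : X (j - 1), S (j - 1) y -> <|z, d X j y|> = 0]].
Arguments harmonic S j : clear implicits.

Definition linear_solution (j : int) (g : X j) (s : X (j - 1)) (u p : X j) :=
  [/\ V X (j - 1) s, V X j u & harmonic (V X) j p] /\
  [/\ forall t, V X (j - 1) t -> <|s, t|> - <|u, d X j t|> = 0,
      forall v, V X j v ->
        <|d X j s, v|> + <|d X (j + 1) u, d X (j + 1) v|> + <|p, v|> = <|g, v|> &
      forall q, harmonic (V X) j q -> <|u, q|> = 0].

Definition K (j : int) (g : X j) : X j :=
  xget 0 [set u | exists s p, linear_solution g s u p].

(* The continuous problem is the case S = V X, the discrete one S = V_h. *)
Definition semilinear_solution (S : forall j, set (X j)) (k : int)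
    (F : X k -> X k) (f : X k) (s : X (k - 1)) (u p : X k) :=
  [/\ S (k - 1) s, S k u & harmonic S k p] /\
  [/\ forall t, S (k - 1) t -> <|s, t|> - <|u, d X k t|> = 0,
      forall v, S k v ->
        <|d X k s, v|> + <|d X (k + 1) u, d X (k + 1) v|> + <|p, v|>
          + <|F (u + p), v|> = <|f, v|> &
      forall q, harmonic S k q -> <|u, q|> = 0].

Definition monotone_op (k : int) (F : X k -> X k) :=
  forall u v, V X k u -> V X k v -> 0 <= <|F u - F v, u - v|>.

Definition V_lipschitz (k : int) (F : X k -> X k) := exists CF : R,
  forall u v, V X k u -> V X k v -> `|F u - F v| <= CF * normV (u - v).

Definition V_closed (j : int) (A : set (X j)) := forall x, V X j x ->
  (forall e : R, 0 < e -> exists2 y, A y & normV (x - y) < e) -> A x.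

Definition subcomplex (Vh : forall j, set (X j)) :=
  [/\ forall j, linear_subspace (Vh j), forall j, Vh j `<=` V X j,
      forall j, V_closed (Vh j) &
      forall i j, j = i + 1 -> forall x : X i, Vh i x -> Vh j (d X j x)].

(* Only the values of pi on V matter. *)
Definition cochain_projection (Vh : forall j, set (X j)) (pi : forall j, X j -> X j) :=
  [/\ forall j, linear_on (V X j) (pi j),
      forall j, pi j @` V X j = Vh j,
      forall j x, V X j x -> pi j (pi j x) = pi j x &
      forall i j, j = i + 1 -> forall x : X i, V X i x ->
        d X j (pi i x) = pi j (d X j x)].

Definition uniformly_W_bounded (I : Type) (pi : I -> forall j, X j -> X j) :=
  forall j, exists C : R, forall h x, V X j x -> `|pi h j x| <= C * `|x|.

Section Errors.
Variable pi : forall j, X j -> X j.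

Definition defect (j : int) (x : X j) : X j := x - dense_extension (V X j) (@pi j) x.

Definition delta (k : int) : R := opnorm (fun g : X k => defect (K g)).

Definition mu (k : int) : R :=
  opnorm (fun x : X k => defect (orth_proj (harmonic (V X) k) x)).

Definition norm_dK (i j : int) : R := opnorm (fun g : X i => defect (d X j (K g))).

Definition norm_dstarK (i j : int) : R :=
  opnorm (fun g : X j => defect (dstar i (K g))).

Definition eta (k : int) : R :=
  Num.max (Num.max (norm_dK k (k + 1)) (norm_dstarK (k - 1) k))
          (Num.max (norm_dK (k - 1) k) (norm_dstarK k (k + 1))).

End Errors.

End Complex.

Arguments Vstar {R} X i j.
Arguments bdry {R} X j.
Arguments harmonic {R X} S j.
Arguments compactness_property {R} X.
Arguments closed_complex {R} X.

(* Main.v *)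
Require Import Defs.
From mathcomp Require Import all_boot all_order all_algebra.
From mathcomp Require Import all_classical all_reals all_analysis.
From mathcomp Require Import ring lra.
Set Implicit Arguments.
Unset Strict Implicit.
Unset Printing Implicit Defensive.
Import Order.TTheory GRing.Theory Num.Theory.
Import numFieldNormedType.Exports.
Local Open Scope classical_set_scope.
Local Open Scope ring_scope.

(** Let (s', u', p') be the discrete linear solution for the data
    g = f - F (u + p), for which (s, u, p) is the continuous linear solution.
    By discrete stability and the monotonicity of F, the semilinear discrete
    solution differs from (s', u', p') by at most a constant times
    |u - u'|_V + |p - p'|, so it suffices to prove the linear error estimates
    of Arnold, Falk and Winther.

    The Poincare inequality |v| <= c |d v| on the complement of the cycles follows
    from compactness: unit vectors v_n with d v_n -> 0 would cluster at a unit
    cycle orthogonal to all cycles. Cochain projections transfer it to V_h. The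
    refined powers of eta, delta and mu come from duality: a discrete y orthogonal
    to the discrete cycles is compared with the continuous y' = d^* K (d y), for
    which |y - y'| <= eta |d y| and <s - s', y'> = <d (s - s'), (I - pi) K (d y)>
    since d (s - s') is orthogonal to d V_h. *)

(** * Hilbert spaces *)

(** Monotonicity enters through the energy identity. The difference of the two discrete solutions
    solves the linear problem with data [F (uh + ph) - F (u + p)]; tested against that difference,
    the part [F (uh + ph) - F (u' + p')] has a favourable sign. What remains is controlled by the
    distance from (u, p) to (u', p'), whatever the size of the Lipschitz constant. The obstacle in
    the linear estimates is that discrete harmonic forms are not harmonic, and that forms orthogonal
    to the discrete cycles are not orthogonal to all cycles. The former are compared with their
    harmonic part, the latter with a continuous form of the same differential, in both cases at a
    distance bounded by a projection error: this is the origin of mu and eta. The duality uses [K]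
    in degrees k - 1, k and k + 1. The nonlinear coupling feeds the error of u and p into every
    component. Hence the bound on d sigma, which is E(d sigma) alone in the linear case, acquires
    the other terms; surplus factors eta, delta and mu are absorbed at the end, being bounded
    uniformly in h. *)

Lemma sqr_le_mul_le {R : realDomainType} (t c : R) :
  0 <= c -> t ^+ 2 <= c * t -> t <= c.
Proof.
move=> c0; rewrite expr2; have [//|ct] := leP t c.
by rewrite ler_pM2r ?(le_lt_trans c0) // leNgt ct.
Qed.

Lemma sqrt_sqrD_le {R : rcfType} (a b : R) : 0 <= a -> 0 <= b ->
  Num.sqrt (a ^+ 2 + b ^+ 2) <= a + b.
Proof.
move=> a0 b0; rewrite -[leRHS]ger0_norm ?addr_ge0 // -sqrtr_sqr ler_sqrt ?sqr_ge0 //.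
by have := mulr_ge0 a0 b0; rewrite sqrrD; lra.
Qed.

Section HilbertSpace.
Context {R : realType} {W : hilbertType R}.
Implicit Types (x y z : W) (A : set W).

Lemma innerC x y : <|x, y|> = <|y, x|>.
Proof.
have := @hermC R false _ W (@inner R W) x y.
by rewrite expr0 mul1r.
Qed.

Lemma innerDl x y z : <|x + y, z|> = <|x, z|> + <|y, z|>.
Proof. exact: linearDl. Qed.
Lemma innerNl x z : <|- x, z|> = - <|x, z|>.
Proof. exact: linearNl. Qed.
Lemma innerBl x y z : <|x - y, z|> = <|x, z|> - <|y, z|>.
Proof. exact: linearBl. Qed.
Lemma innerZl (a : R) x z : <|a *: x, z|> = a * <|x, z|>.
Proof. exact: linearZl_LR. Qed.
Lemma inner0l z : <|0, z|> = 0.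
Proof. exact: linear0l. Qed.


Lemma innerDr z x y : <|z, x + y|> = <|z, x|> + <|z, y|>.
Proof. by rewrite innerC innerDl !(innerC z). Qed.
Lemma innerNr z x : <|z, - x|> = - <|z, x|>.
Proof. by rewrite innerC innerNl innerC. Qed.
Lemma innerBr z x y : <|z, x - y|> = <|z, x|> - <|z, y|>.
Proof. by rewrite innerDr innerNr. Qed.
Lemma innerZr (a : R) z x : <|z, a *: x|> = a * <|z, x|>.
Proof. by rewrite innerC innerZl innerC. Qed.
Lemma inner0r z : <|z, 0|> = 0.
Proof. by rewrite innerC inner0l. Qed.

Lemma inner_ge0 x : 0 <= <|x, x|>.
Proof.
have [->|/(neq0_dnorm_gt0 (s := inner)) /ltW//] := eqVneq x 0.
by rewrite inner0l.
Qed.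

Lemma innerxx x : <|x, x|> = `|x| ^+ 2.
Proof. by rewrite norm_inner sqr_sqrtr ?inner_ge0. Qed.

Lemma inner_norm x y : `|<|x, y|>| <= `|x| * `|y|.
Proof.
have [->|y0] := eqVneq y 0; first by rewrite inner0r !normr0 mulr0.
have Y : 0 < `|y| ^+ 2 by rewrite exprn_gt0 // normr_gt0.
rewrite -ler_sqr ?nnegrE ?mulr_ge0 // real_normK ?num_real // exprMn.
have := inner_ge0 (x - (<|x, y|> / `|y| ^+ 2) *: y).
rewrite !(innerBl, innerBr) !(innerZl, innerZr) (innerC y x) !innerxx.
set a := <|x, y|>; set Y2 := `|y| ^+ 2; move=> h.
rewrite -subr_ge0; move: h; rewrite -(pmulr_rge0 _ Y) -/Y2.
by congr (_ <= _); field; rewrite gt_eqF.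
Qed.

Lemma inner_le x y : <|x, y|> <= `|x| * `|y|.
Proof. exact: le_trans (ler_norm _) (inner_norm _ _). Qed.

Lemma closed_approx A x : closed A ->
  (forall e : R, 0 < e -> exists2 y, A y & `|x - y| < e) -> A x.
Proof.
move=> clA h; apply: clA => B /nbhs_ballP[e e0 eB].
have [y Ay xy] := h _ e0; exists y; split=> //; apply: eB.
by rewrite -ball_normE.
Qed.

Lemma closedW A :
  (forall x, (forall e : R, 0 < e -> exists2 y, A y & `|x - y| < e) -> A x) ->
  closed A.
Proof.
move=> h x clx; apply: h => e e0.
have [y [Ay xy]] := clx (ball x e) (nbhsx_ballx _ _ e0).
by exists y => //; move: xy; rewrite -ball_normE.
Qed.

Lemma cauchy_limit (x_ : nat -> W) :
  (forall e : R, 0 < e -> exists N, forall m n, (N <= m)%N -> (N <= n)%N ->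
     `|x_ m - x_ n| < e) ->
  exists z, forall e : R, 0 < e -> exists N, forall n, (N <= n)%N ->
     `|z - x_ n| < e.
Proof.
move=> h.
have /cauchy_cvgP cx : cauchy (x_ @ \oo).
  apply/cauchy_exP => e e0; have [N hN] := h _ e0.
  exists (x_ N); exists N => // n /= Nn.
  by rewrite -ball_normE /=; apply: hN.
exists (lim (x_ @ \oo)) => e e0.
have /cvgrPdist_lt/(_ e e0)[N _ hN] := cx.
by exists N => n Nn; apply: hN.
Qed.

End HilbertSpace.

(** * Closed subspaces: Riesz representation, orthogonal projection, best approximation *)

Section Subspace.
Context {R : realType} {W : hilbertType R} (A : set W).
Hypothesis subA : linear_subspace A.
Implicit Types (x y z : W).

Lemma subspace0 : A 0. Proof. by case: subA. Qed.

Lemma subspaceZ (a : R) x : A x -> A (a *: x).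
Proof. by case: subA => A0 /(_ a x 0) h Ax; rewrite -[_ *: _]addr0; apply: h. Qed.

Lemma subspaceD x y : A x -> A y -> A (x + y).
Proof. by case: subA => _ /(_ 1 x y) h Ax Ay; rewrite -[x]scale1r; apply: h. Qed.

Lemma subspaceN x : A x -> A (- x).
Proof. by rewrite -scaleN1r; apply: subspaceZ. Qed.

Lemma subspaceB x y : A x -> A y -> A (x - y).
Proof. by move=> Ax Ay; apply: subspaceD => //; apply: subspaceN. Qed.

Section LinearOn.
Context {W' : hilbertType R} (f : W -> W').
Hypothesis linf : linear_on A f.

Lemma linear_onD x y : A x -> A y -> f (x + y) = f x + f y.
Proof. by move=> Ax Ay; rewrite -[in LHS](scale1r x) linf // scale1r. Qed.

Lemma linear_on0 : f 0 = 0.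
Proof.
have := linear_onD subspace0 subspace0; rewrite addr0 => /eqP.
by rewrite -subr_eq0 opprD addrA subrr sub0r oppr_eq0 => /eqP.
Qed.

Lemma linear_onZ (a : R) x : A x -> f (a *: x) = a *: f x.
Proof.
by move=> Ax; rewrite -[a *: x]addr0 linf ?linear_on0 ?addr0 //; apply: subspace0.
Qed.

Lemma linear_onN x : A x -> f (- x) = - f x.
Proof. by move=> Ax; rewrite -scaleN1r linear_onZ // scaleN1r. Qed.

Lemma linear_onB x y : A x -> A y -> f (x - y) = f x - f y.
Proof. by move=> Ax Ay; rewrite linear_onD ?linear_onN //; apply: subspaceN. Qed.

End LinearOn.

Hypothesis clA : closed A.

Section Riesz.
Context (ell : W -> R) (C : R).
Hypothesis linell : forall (a : R) x y, A x -> A y ->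
  ell (a *: x + y) = a * ell x + ell y.
Hypothesis bdell : forall x, A x -> `|ell x| <= C * `|x|.

(** The quadratic energy whose minimizer over [A] represents [ell]. *)
Let J x := `|x| ^+ 2 - 2 * ell x.
Let m := inf (J @` A).

Let m_le x : A x -> m <= J x.
Proof.
move=> Ax; apply: ge_inf; last by exists x.
(* The energy is at least (|y| - C)^2 - C^2. *)
exists (- C ^+ 2) => _ [y Ay <-]; rewrite /J.
have := bdell Ay; rewrite ler_norml => /andP[_ h].
have := sqr_ge0 (`|y| - C); rewrite sqrrB; nra.
Qed.

Let Jline x y t : A x -> A y ->
  J (x + t *: y) = J x + 2 * t * (<|x, y|> - ell y) + t ^+ 2 * `|y| ^+ 2.
Proof.
move=> Ax Ay; rewrite /J [x + _]addrC linell // -!innerxx.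
rewrite !(innerDl, innerDr) !(innerZl, innerZr) (innerC y x); ring.
Qed.

(* The discriminant of t |-> J (x + t y) - m is nonpositive. *)
Let near_min_inner (e : R) x y : 0 <= e -> A x -> A y -> J x <= m + e ^+ 2 ->
  `|<|x, y|> - ell y| <= e * `|y|.
Proof.
move=> e0 Ax Ay Jx.
have [->|y0] := eqVneq y 0.
  have -> : ell 0 = 0.
    by have := linell 1 subspace0 subspace0; rewrite scaler0 addr0; lra.
  by rewrite inner0r subrr !normr0 mulr0.
have Y : 0 < `|y| ^+ 2 by rewrite exprn_gt0 // normr_gt0.
rewrite -ler_sqr ?nnegrE ?mulr_ge0 // real_normK ?num_real // exprMn.
set q := _ - _; set Y2 := `|y| ^+ 2 in Y *.
have := m_le (subspaceD Ax (subspaceZ (- (q / Y2)) Ay)).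
rewrite Jline // -/q -/Y2.
have -> : J x + 2 * - (q / Y2) * q + (- (q / Y2)) ^+ 2 * Y2 = J x - q ^+ 2 / Y2.
  by field; rewrite gt_eqF.
move=> h; rewrite -ler_pdivrMr //; lra.
Qed.

(** Testing both near-minimality relations with [x - y] and subtracting cancels [ell]. Minimizing
    sequences are therefore Cauchy. *)
Let near_min_dist (e : R) x y : 0 <= e -> A x -> A y ->
  J x <= m + e ^+ 2 -> J y <= m + e ^+ 2 -> `|x - y| <= 2 * e.
Proof.
move=> e0 Ax Ay Jx Jy.
have h1 := near_min_inner e0 Ax (subspaceB Ax Ay) Jx.
have h2 := near_min_inner e0 Ay (subspaceB Ax Ay) Jy.
apply: sqr_le_mul_le; first by rewrite mulr_ge0.
rewrite -innerxx innerBl.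
have -> : <|x, x - y|> - <|y, x - y|> =
  (<|x, x - y|> - ell (x - y)) - (<|y, x - y|> - ell (x - y)) by ring.
by apply: le_trans (ler_norm _) _; apply: le_trans (ler_normB _ _) _; lra.
Qed.

(** The near-minimality relation passes to the limit of a minimizing sequence. Linearity and
    boundedness are asked on [A] only, so that [ell] may be built from a choice of preimages under
    [d], as in [coboundary_dual]. *)
Lemma riesz : exists2 z, A z & forall y, A y -> <|z, y|> = ell y.
Proof.
have inv_gt0 n : 0 < (n.+1%:R : R)^-1 by rewrite invr_gt0.
(* The excess is a square because [near_min_inner] returns its square root. *)
have /boolp.choice[x_ hx] (n : nat) : exists y,
    A y /\ J y <= m + (n.+1%:R^-1) ^+ 2.
  have hi : has_inf (J @` A).
    split; first by exists (J 0); exists 0 => //; apply: subspace0.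
    by exists m => _ [y Ay <-]; apply: m_le.
  have e0 : 0 < (n.+1%:R^-1 : R) ^+ 2 by rewrite exprn_gt0.
  by have [_ [y Ay <-] /ltW hy] := inf_adherent e0 hi; exists y.
have small (e : R) : 0 < e -> exists N, forall n, (N <= n)%N -> n.+1%:R^-1 < e.
  move=> e0; have [N _ hN] := near_infty_natSinv_lt (PosNum e0).
  by exists N => n /hN.
have mono (N n : nat) : (N <= n)%N -> J (x_ n) <= m + (N.+1%:R^-1) ^+ 2.
  move=> Nn; apply: le_trans (hx n).2 _; rewrite lerD2l.
  have : n.+1%:R^-1 <= N.+1%:R^-1 :> R.
    by rewrite lef_pV2 ?posrE ?ltr0n // ler_nat ltnS.
  have := ltW (inv_gt0 n); have := ltW (inv_gt0 N) => N0 n0.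
  by apply: lerXn2r; rewrite nnegrE.
have [|z hz] := @cauchy_limit _ _ x_.
  move=> e e0; have [|N hN] := small (e / 2); first by lra.
  exists N => i j Ni Nj; have /(_ N (leqnn _)) h := hN.
  have := near_min_dist (ltW (inv_gt0 N)) (hx i).1 (hx j).1 (mono _ _ Ni) (mono _ _ Nj).
  by move: h; move: (N.+1%:R^-1) => a; lra.
exists z.
  apply: closed_approx => // e /hz[N /(_ N (leqnn _)) hN].
  by exists (x_ N) => //; case: (hx N).
move=> y Ay; apply/eqP; rewrite -subr_eq0 -normr_le0; apply/ler_addgt0Pr => e e0.
rewrite add0r.
have Y1 : 0 < `|y| + 1 by rewrite ltr_wpDl.
have e1 : 0 < e / 2 / (`|y| + 1) by rewrite divr_gt0 // divr_gt0.
have [N1 h1] := hz _ e1; have [N2 h2] := small _ e1.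
pose n := maxn N1 N2.
have := near_min_inner (ltW (inv_gt0 n)) (hx n).1 Ay (hx n).2.
have := h1 n (leq_maxl _ _); have := h2 n (leq_maxr _ _).
set d := e / 2 / _ => g2 g1 g3.
have -> : <|z, y|> - ell y = <|z - x_ n, y|> + (<|x_ n, y|> - ell y).
  by rewrite innerBl; ring.
apply: le_trans (ler_normD _ _) _.
have := inner_norm (z - x_ n) y.
have : d * (`|y| + 1) = e / 2 by rewrite /d divfK // gt_eqF.
have Y0 := normr_ge0 y.
have := ler_wpM2r Y0 (ltW g1); have := ler_wpM2r Y0 (ltW g2).
have : 0 <= d by rewrite ltW.
move: g3; move: (n.+1%:R^-1) => a; lra.
Qed.

End Riesz.

Lemma orthogonal_decomposition x :
  exists2 z, A z & forall y, A y -> <|x - z, y|> = 0.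
Proof.
have [|y Ay|z Az hz] := @riesz (fun y => <|x, y|>) `|x|.
- by move=> a y z _ _; rewrite innerDr innerZr.
- exact: inner_norm.
exists z => // y Ay; by rewrite innerBl hz // subrr.
Qed.

Lemma orth_projE x z : A z -> (forall y, A y -> <|x - z, y|> = 0) ->
  orth_proj A x = z.
Proof.
move=> Az hz; apply: xget_unique; first by split.
move=> z' [Az' hz']; apply/eqP; rewrite -subr_eq0 -normr_eq0 -sqrf_eq0.
rewrite -innerxx; apply/eqP.
have D := subspaceB Az' Az.
have -> : <|z' - z, z' - z|> = <|x - z, z' - z|> - <|x - z', z' - z|>.
  by rewrite !innerBl; ring.
by rewrite hz // hz' // subrr.
Qed.

Lemma best_approx_ge0 x : 0 <= best_approx A x.
Proof.
apply: lb_le_inf; first by exists `|x - 0|; exists 0 => //; apply: subspace0.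
by move=> _ [y _ <-].
Qed.

Lemma le_best_approx x (r c : R) : 0 <= c ->
  (forall y, A y -> r <= c * `|x - y|) -> r <= c * best_approx A x.
Proof.
rewrite le_eqVlt => /orP[/eqP<- h|c0 h].
  by have := h 0 subspace0; rewrite !mul0r.
rewrite -ler_pdivrMl // lb_le_inf //.
  by exists `|x - 0|; exists 0 => //; apply: subspace0.
by move=> _ [y Ay <-]; rewrite ler_pdivrMl //; apply: h.
Qed.

End Subspace.

(** * Operator norms and extension by continuity *)

Section Operators.
Context {R : realType} {W W' : hilbertType R}.

Lemma opnorm_le (f : W -> W') (C : R) :
  0 <= C -> (forall x, `|f x| <= C * `|x|) -> opnorm f <= C.
Proof.
move=> C0 h; apply: ge_sup.
  by exists `|f 0|; exists 0 => //=; rewrite normr0.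
by move=> _ [x /= x1 <-]; apply: le_trans (h x) _; rewrite ler_piMr.
Qed.

(** The a priori bound [C] makes the supremum genuine, as [sup] is 0 on unbounded sets. *)
Lemma opnorm_ge (f : W -> W') (C : R) (x : W) : 0 <= C ->
  (forall x, `|f x| <= C * `|x|) -> `|x| <= 1 -> `|f x| <= opnorm f.
Proof.
move=> C0 h x1; apply: ub_le_sup; last by exists x.
by exists C => _ [y /= y1 <-]; apply: le_trans (h y) _; rewrite ler_piMr.
Qed.

Lemma opnorm_ge0 (f : W -> W') (C : R) : 0 <= C ->
  (forall x, `|f x| <= C * `|x|) -> 0 <= opnorm f.
Proof.
move=> C0 h; apply: le_trans (opnorm_ge (x := 0) C0 h _); first exact: normr_ge0.
by rewrite normr0.
Qed.

Lemma le_opnorm (f : W -> W') (C : R) (x : W) : 0 <= C ->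
  (forall a x, f (a *: x) = a *: f x) -> (forall x, `|f x| <= C * `|x|) ->
  `|f x| <= opnorm f * `|x|.
Proof.
move=> C0 fZ h.
have [x0|x0] := eqVneq x 0.
  have -> : f x = 0 by rewrite x0 -(scale0r 0) fZ scale0r.
  by rewrite x0 !normr0 mulr0.
have nx : 0 < `|x| by rewrite normr_gt0.
rewrite -ler_pdivrMr // mulrC -[_^-1]ger0_norm ?invr_ge0 // -normrZ -fZ.
apply: opnorm_ge C0 h _.
by rewrite normrZ ger0_norm ?invr_ge0 // mulVf // gt_eqF.
Qed.

(** A bounded linear map is continuous on [A], so its limit along [A] at a point of [A] is its value
    there. This lets the defect of an element of V be read as [x - pi x]. *)
Lemma dense_extensionE (A : set W) (f : W -> W) (C : R) (x : W) :
  linear_subspace A -> linear_on A f -> (forall x, A x -> `|f x| <= C * `|x|) ->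
  A x -> dense_extension A f x = f x.
Proof.
move=> subA linf bdf Ax.
have PF : ProperFilter (within A (nbhs x)).
  split; last exact: within_filter.
  by move=> /nbhs_singleton /(_ Ax).
apply: cvg_lim; first exact: norm_hausdorff.
have C1 : 0 < `|C| + 1 by rewrite ltr_wpDl.
apply/cvgrPdist_lt => e e0; rewrite near_withinE.
have e1 : 0 < e / (`|C| + 1) by rewrite divr_gt0.
near=> y => Ay.
rewrite -(linear_onB subA linf) //.
apply: le_lt_trans (bdf _ (subspaceB subA Ax Ay)) _.
have : `|x - y| < e / (`|C| + 1).
  by near: y; apply: cvgr_dist_lt.
rewrite ltr_pdivlMr // => h; apply: le_lt_trans h; rewrite mulrC ler_wpM2l //.
by rewrite (le_trans (ler_norm _)) // lerDl.
Unshelve. all: by end_near. Qed.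

End Operators.

(** * Subcomplexes and the mixed problem *)

Definition orthogonal_to {R : realType} {W : hilbertType R} (A : set W) (x : W) :=
  forall y, A y -> <|x, y|> = 0.

Section Subcomplexes.
Context {R : realType} (X : hilbert_complex R).

Section Spaces.
Variable S : forall j, set (X j).

(* The degrees are free here, with j = i + 1 and l = j + 1 assumed in the lemmas:
   this avoids casts between j and j + 1 - 1. Thus harmonic S j is
   harmonics (j - 1) j (j + 1). *)
Definition cycles (i j : int) : set (X i) := [set x | S x /\ d X j x = 0].
Arguments cycles i j : clear implicits.

Definition boundaries (i j : int) : set (X j) := d X j @` @S i.
Arguments boundaries i j : clear implicits.

Definition harmonics (i j l : int) : set (X j) :=
  [set z | [/\ S z, d X l z = 0 & forall y : X i, S y -> <|z, d X j y|> = 0]].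
Arguments harmonics i j l : clear implicits.

Definition mixed_solution (i j l : int) (g : X j) (s : X i) (u p : X j) :=
  [/\ S s, S u & harmonics i j l p] /\
  [/\ forall t : X i, S t -> <|s, t|> - <|u, d X j t|> = 0,
      forall v, S v ->
        <|d X j s, v|> + <|d X l u, d X l v|> + <|p, v|> = <|g, v|> &
      forall q, harmonics i j l q -> <|u, q|> = 0].

(** The complement is taken with respect to the cycles of [S] itself, so the inequality for a
    subcomplex is not a restriction of the one for V. *)
Definition poincare (i j : int) (c : R) := forall v : X i,
  S v -> orthogonal_to (cycles i j) v -> `|v| <= c * `|d X j v|.

Lemma poincareW i j c c' : c <= c' -> poincare i j c -> poincare i j c'.
Proof.
move=> cc h v Sv vZ; apply: le_trans (h v Sv vZ) _.
by rewrite ler_wpM2r.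
Qed.

End Spaces.

Lemma subcomplexV : subcomplex (V X).
Proof.
split=> [j|j x //|j x Vx _ //|i j e x Vx]; first exact: V_subspace.
exact: (@d_dom R X i j e).
Qed.

Lemma closed_graph i j x w : j = i + 1 ->
  (forall e : R, 0 < e ->
     exists2 v, V X i v & `|x - v| < e /\ `|w - d X j v| < e) ->
  V X i x /\ d X j x = w.
Proof.
move=> eij h.
suff : [set xy : X i * X j | V X i xy.1 /\ xy.2 = d X j xy.1] (x, w) by move=> [].
apply: (d_closed R X i j eij) => B /nbhs_ballP[e e0 eB].
have [v Vv [xv wv]] := h _ e0; exists (v, d X j v); split=> //; apply: eB.
by split => /=; rewrite -ball_normE.
Qed.

Arguments cycles S i j : clear implicits.
Arguments boundaries S i j : clear implicits.
Arguments harmonics S i j l : clear implicits.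
Arguments poincare S i j c : clear implicits.
Arguments mixed_solution S i j l g s u p : clear implicits.

(** * Hodge decomposition, solvability and stability on a subcomplex *)

Section Subcomplex.
Variable S : forall j, set (X j).
Hypothesis hS : subcomplex S.

Let subS j : linear_subspace (@S j). Proof. by case: hS. Qed.
Let SV j : @S j `<=` V X j. Proof. by case: hS. Qed.

Lemma sub_d_linear i j : j = i + 1 -> linear_on (@S i) (d X j).
Proof. by move=> e a x y Sx Sy; apply: d_linear => //; apply: SV. Qed.

Lemma sub_d i j (x : X i) : j = i + 1 -> S x -> S (d X j x).
Proof. by case: hS => _ _ _ h e Sx; apply: h. Qed.

Lemma sub_dd i j l (x : X i) : j = i + 1 -> l = j + 1 -> S x ->
  d X l (d X j x) = 0.
Proof. by move=> e e' Sx; apply: (d_d R X i j l) => //; apply: SV. Qed.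

Lemma sub_closed_graph i j (x : X i) w : j = i + 1 ->
  (forall e : R, 0 < e -> exists2 v, S v & `|x - v| < e /\ `|w - d X j v| < e) ->
  S x /\ d X j x = w.
Proof.
move=> eij h; subst j.
have [|Vx dx] := @closed_graph i _ x w erefl.
  by move=> e /h[v Sv hv]; exists v => //; apply: SV.
split=> //; have [_ _ clS _] := hS; apply: (clS i) => // e e0.
have [|v Sv [xv dv]] := h (e / 2); first by lra.
exists v => //; rewrite /normV (linear_onB (V_subspace R X i)) ?dx //; last first.
- exact: SV.
- exact: d_linear.
apply: le_lt_trans (sqrt_sqrD_le _ _) _ => //; lra.
Qed.

Lemma cycles_subspace i j : j = i + 1 -> linear_subspace (cycles S i j).
Proof.
move=> eij; have lind := sub_d_linear eij.
split=> [|a x y [Sx dx] [Sy dy]].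
  by split; [exact: subspace0|exact: linear_on0 lind].
by split; [apply: (subS i).2|rewrite lind // dx dy scaler0 addr0].
Qed.

(** [S] is closed in the V-norm only, but the V-norm and the W-norm coincide on cycles. *)
Lemma cycles_closed i j : j = i + 1 -> closed (cycles S i j).
Proof.
move=> eij; apply: closedW => x h; apply: sub_closed_graph => // e /h[y [Sy dy] xy].
by exists y => //; rewrite dy subrr normr0; split=> //; apply: le_lt_trans xy.
Qed.

Lemma boundaries_subspace i j : j = i + 1 -> linear_subspace (boundaries S i j).
Proof.
move=> eij; have lind := sub_d_linear eij.
split=> [|a _ _ [x Sx <-] [y Sy <-]].
  by exists 0; [exact: subspace0|exact: linear_on0 lind].
by exists (a *: x + y); [apply: (subS i).2|rewrite lind].
Qed.

Lemma boundaries_cycles i j l b : j = i + 1 -> l = j + 1 ->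
  boundaries S i j b -> cycles S j l b.
Proof. by move=> e e' [x Sx <-]; split; [exact: sub_d|exact: sub_dd]. Qed.

Lemma boundary_lift i j b : j = i + 1 -> boundaries S i j b ->
  exists y, [/\ S y, orthogonal_to (cycles S i j) y & d X j y = b].
Proof.
move=> eij [x Sx <-].
have [z [Sz dz] xz] := orthogonal_decomposition (cycles_subspace eij) (cycles_closed eij) x.
exists (x - z); split=> //; first exact: subspaceB.
by rewrite (linear_onB (subS i) (sub_d_linear eij)) // dz subr0.
Qed.

Lemma orthogonal_toB (W : hilbertType R) (A : set W) (x y : W) :
  orthogonal_to A x -> orthogonal_to A y -> orthogonal_to A (x - y).
Proof. by move=> Ax Ay z Az; rewrite innerBl Ax // Ay // subrr. Qed.

(** By the Poincare inequality, the preimages orthogonal to the cycles of a convergent sequence of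
    boundaries form a Cauchy sequence; the closed graph identifies the limit. *)
Lemma boundaries_closed i j c : j = i + 1 -> 0 <= c -> poincare S i j c ->
  closed (boundaries S i j).
Proof.
move=> eij c0 hP; apply: closedW => x h.
have lind := sub_d_linear eij.
have inv_gt0 n : 0 < (n.+1%:R : R)^-1 by rewrite invr_gt0.
have small (e : R) : 0 < e -> exists N, forall n, (N <= n)%N -> n.+1%:R^-1 < e.
  move=> e0; have [N _ hN] := near_infty_natSinv_lt (PosNum e0).
  by exists N => n /hN.
have /boolp.choice[y_ hy] (n : nat) : exists y,
    [/\ S y, orthogonal_to (cycles S i j) y & `|x - d X j y| < n.+1%:R^-1].
  by have [b /(boundary_lift eij)[y [Sy yZ <-]] xb] := h _ (inv_gt0 n); exists y.
have [|y hlim] := @cauchy_limit _ _ y_.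
  move=> e e0; have c1 : 0 < c + 1 by rewrite ltr_wpDl.
  have [|N hN] := small (e / 2 / (c + 1)); first by rewrite !divr_gt0.
  exists N => m n Nm Nn; have [Sm mZ xm] := hy m; have [Sn nZ xn] := hy n.
  apply: le_lt_trans (hP _ (subspaceB (subS i) Sm Sn) (orthogonal_toB mZ nZ)) _.
  rewrite (linear_onB (subS i) lind) //.
  have dmn : `|d X j (y_ m) - d X j (y_ n)| <= e / (c + 1).
    have -> : d X j (y_ m) - d X j (y_ n) = (x - d X j (y_ n)) - (x - d X j (y_ m)).
      by rewrite opprB [RHS]addrC addrA subrK.
    apply: le_trans (ler_normB _ _) _.
    have := lt_trans xm (hN _ Nm); have := lt_trans xn (hN _ Nn).
    have -> : e / 2 / (c + 1) = e / (c + 1) / 2 by rewrite mulrAC.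
    lra.
  apply: le_lt_trans (ler_wpM2l c0 dmn) _.
  rewrite mulrA ltr_pdivrMr // mulrC ltr_pM2l //; lra.
suff [Sy <-] : S y /\ d X j y = x by exists y.
apply: sub_closed_graph => // e e0.
have [N1 h1] := hlim _ e0; have [N2 h2] := small _ e0.
pose n := maxn N1 N2; have [Sn _ xn] := hy n.
exists (y_ n) => //; split; first exact: h1 (leq_maxl _ _).
exact: lt_trans xn (h2 _ (leq_maxr _ _)).
Qed.

(** Weak solution of the adjoint equation with right-hand side [x]. As [x] is orthogonal to the
    cycles, [d t |-> <x, t>] is well defined on the boundaries; the Poincare inequality bounds it,
    and [riesz] represents it. *)
Lemma coboundary_dual i j c x : j = i + 1 -> 0 <= c -> poincare S i j c ->
  orthogonal_to (cycles S i j) x ->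
  exists2 b, boundaries S i j b & forall t, S t -> <|b, d X j t|> = <|x, t|>.
Proof.
move=> eij c0 hP xZ; have lind := sub_d_linear eij.
have /boolp.choice[L hL] (b : X j) : exists y, boundaries S i j b ->
    [/\ S y, orthogonal_to (cycles S i j) y & d X j y = b].
  have [/(boundary_lift eij)[y hy]|nb] := pselect (boundaries S i j b); first by exists y.
  by exists 0.
have xS y y' : S y -> S y' -> d X j y = d X j y' -> <|x, y|> = <|x, y'|>.
  move=> Sy Sy' dy; apply/eqP; rewrite -subr_eq0 -innerBr xZ //.
  split; first exact: subspaceB.
  by rewrite (linear_onB (subS i) lind) // dy subrr.
have B0 := boundaries_subspace eij.
have [a b1 b2 /[dup] Bb1 /hL[S1 _ d1] /[dup] Bb2 /hL[S2 _ d2]|b /hL[Sb bZ db]|b Bb hb]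
    := @riesz _ _ _ B0 (boundaries_closed eij c0 hP) (fun b => <|x, L b|>) (`|x| * c).
- rewrite -innerZr -innerDr; have [|S3 _ d3] := hL (a *: b1 + b2).
    exact: B0.2.
  by apply: xS => //; [apply: (subS i).2|rewrite d3 lind // d1 d2].
- apply: le_trans (inner_norm _ _) _; rewrite -mulrA ler_wpM2l //.
  by have := hP _ Sb bZ; rewrite db.
exists b => // t St; have Bt : boundaries S i j (d X j t) by exists t.
by rewrite hb //; have [? ? ?] := hL _ Bt; apply: xS.
Qed.


(** [x] is projected onto the cycles, and the result onto the boundaries, which the Poincare
    inequality makes closed. As [x] ranges over all of W, the component [y] need not lie in [S]. *)
Lemma hodge_decomposition i j l c x : j = i + 1 -> l = j + 1 -> 0 <= c ->
  poincare S i j c ->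
  exists b h y, [/\ x = b + h + y, boundaries S i j b, harmonics S i j l h &
    orthogonal_to (cycles S j l) y].
Proof.
move=> eij ejl c0 hP.
have [z Zz xz] := orthogonal_decomposition (cycles_subspace ejl) (cycles_closed ejl) x.
have [b Bb zb] :=
  orthogonal_decomposition (boundaries_subspace eij) (boundaries_closed eij c0 hP) z.
exists b, (z - b), (x - z); split=> //; first by rewrite (addrC b) subrK addrC subrK.
have [Sd dd] := subspaceB (cycles_subspace ejl) Zz (boundaries_cycles eij ejl Bb).
by split=> // y Sy; apply: zb; exists y.
Qed.

Lemma harmonics_boundaries i j l h b : harmonics S i j l h ->
  boundaries S i j b -> <|h, b|> = 0.
Proof. by move=> [_ _ hB] [y Sy <-]; apply: hB. Qed.

Lemma harmonics_cycles i j l h : harmonics S i j l h -> cycles S j l h.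
Proof. by case. Qed.

(** The Hodge components of the data decouple the problem. The boundary part is [d s], and [s]
    yields by duality the boundary part [b1] of [u]; the harmonic part is [p]; the remainder is dual
    to a boundary [b2], whose lift [r] is the rest of [u]. *)
Lemma mixed_solution_exists i j l c c' g : j = i + 1 -> l = j + 1 ->
  0 <= c -> 0 <= c' -> poincare S i j c -> poincare S j l c' ->
  exists s u p, mixed_solution S i j l g s u p.
Proof.
move=> eij ejl c0 c'0 hP hP'.
have [b [p [y [-> Bb Hp yZ]]]] := hodge_decomposition g eij ejl c0 hP.
have [s [Ss sZ ds]] := boundary_lift eij Bb.
have [b1 Bb1 hb1] := coboundary_dual eij c0 hP sZ.
have [b2 Bb2 hb2] := coboundary_dual ejl c'0 hP' yZ.
have [r [Sr rZ dr]] := boundary_lift ejl Bb2.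
have [Sb1 db1] := boundaries_cycles eij ejl Bb1.
exists s, (b1 + r), p; split; first by split=> //; apply: subspaceD.
split=> [t St|v Sv|q Hq].
- rewrite innerDl hb1 // rZ ?addr0 ?subrr //.
  by apply: (boundaries_cycles eij ejl); exists t.
- rewrite ds (linear_onD (sub_d_linear ejl)) // db1 add0r dr hb2 //.
  by rewrite !innerDl; ring.
- rewrite innerDl rZ ?addr0; last exact: harmonics_cycles Hq.
  by rewrite innerC (harmonics_boundaries Hq).
Qed.

Lemma mixed_solution_lin i j l (a : R) g s u p g' s' u' p' :
  j = i + 1 -> l = j + 1 ->
  mixed_solution S i j l g s u p -> mixed_solution S i j l g' s' u' p' ->
  mixed_solution S i j l (a *: g + g') (a *: s + s') (a *: u + u') (a *: p + p').
Proof.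
move=> eij ejl [[Ss Su [Sp dp pB]] [e1 e2 e3]] [[Ss' Su' [Sp' dp' pB']] [e1' e2' e3']].
have li := sub_d_linear eij; have lj := sub_d_linear ejl.
have sub k := (subS k).2.
split; first split; [exact: sub|exact: sub|split|split].
- exact: sub.
- by rewrite lj // dp dp' scaler0 addr0.
- by move=> y Sy; rewrite innerDl innerZl pB // pB' // mulr0 addr0.
- move=> t St; rewrite !innerDl !innerZl.
  have -> : <|s, t|> = <|u, d X j t|> by have := e1 t St; lra.
  have -> : <|s', t|> = <|u', d X j t|> by have := e1' t St; lra.
  by rewrite subrr.
- move=> v Sv; rewrite li // lj // !innerDl !innerZl -e2 // -e2' //; ring.
- by move=> q Hq; rewrite innerDl innerZl e3 // e3' // mulr0 addr0.
Qed.

(** The second equation is tested with [u + p] and the first with [s]; the cross terms with [p]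
    vanish. *)
Lemma mixed_solution_energy i j l g s u p : j = i + 1 -> l = j + 1 ->
  mixed_solution S i j l g s u p ->
  `|s| ^+ 2 + `|d X l u| ^+ 2 + `|p| ^+ 2 = <|g, u + p|>.
Proof.
move=> eij ejl [[Ss Su Hp] [e1 e2 e3]]; have [Sp dp pB] := Hp.
rewrite innerDr -!e2 // dp inner0r -!innerxx.
have -> : <|s, s|> = <|d X j s, u|> by rewrite innerC; have := e1 s Ss; rewrite innerC; lra.
by rewrite (innerC p u) e3 // (innerC (d X j s) p) pB //; ring.
Qed.

Lemma mixed_solution_boundary i j l g s u p : j = i + 1 -> l = j + 1 ->
  mixed_solution S i j l g s u p -> `|d X j s| <= `|g|.
Proof.
move=> eij ejl [[Ss Su [Sp dp pB]] [e1 e2 e3]].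
apply: sqr_le_mul_le => //; rewrite -innerxx.
suff -> : <|d X j s, d X j s|> = <|g, d X j s|> by exact: inner_le.
rewrite -e2 ?pB //; last exact: sub_d.
by rewrite (sub_dd eij ejl) // inner0r !addr0.
Qed.

(** The side conditions bound the boundary part of [u] by [c * |s|] and remove its harmonic part;
    the rest is at most [c * |d u|]. The second equation is replaced by an energy inequality
    because, for semilinear solutions, monotonicity gives an [M] better than the norm of the
    data. *)
Lemma mixed_solution_stable i j l c M s u p : j = i + 1 -> l = j + 1 ->
  0 <= c -> poincare S i j c -> poincare S j l c ->
  S s -> S u -> harmonics S i j l p ->
  (forall t : X i, S t -> <|s, t|> - <|u, d X j t|> = 0) ->
  (forall q, harmonics S i j l q -> <|u, q|> = 0) ->
  0 <= M ->
  `|s| ^+ 2 + `|d X l u| ^+ 2 + `|p| ^+ 2 <= M * (`|u| + `|p|) ->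
  `|s| + `|d X l u| + `|u| + `|p| <= 3 * (c + 1) ^+ 2 * M.
Proof.
move=> eij ejl c0 hP hP' Ss Su Hp e1 e3 M0 en.
have [b [h [y [eu Bb Hh yZ]]]] := hodge_decomposition u eij ejl c0 hP.
have h0 : h = 0.
  apply/eqP; rewrite -normr_eq0 -sqrf_eq0 -innerxx; apply/eqP.
  have := e3 _ Hh; rewrite eu !innerDl yZ ?addr0; last exact: harmonics_cycles Hh.
  by rewrite innerC (harmonics_boundaries Hh) // add0r.
rewrite h0 addr0 in eu.
have [Sb db] := boundaries_cycles eij ejl Bb.
have eyu : y = u - b by rewrite eu addrAC subrr add0r.
have uy : `|y| <= c * `|d X l u|.
  have -> : d X l u = d X l y.
    by rewrite eyu (linear_onB (subS j) (sub_d_linear ejl)) // db subr0.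
  by apply: hP' => //; rewrite eyu; apply: subspaceB.
have ub : `|b| <= c * `|s|.
  have [r [Sr rZ dr]] := boundary_lift eij Bb.
  apply: sqr_le_mul_le; first by rewrite mulr_ge0.
  have -> : `|b| ^+ 2 = <|s, r|>.
    have := e1 _ Sr; rewrite dr eu innerDl yZ; last exact: (boundaries_cycles eij ejl Bb).
    by rewrite innerxx; lra.
  apply: le_trans (inner_le _ _) _.
  by have := ler_wpM2l (normr_ge0 s) (hP _ Sr rZ); rewrite dr; lra.
have uU : `|u| <= `|b| + `|y| by rewrite eu ler_normD.
move: en uU uy ub; move: (normr_ge0 s) (normr_ge0 (d X l u)) (normr_ge0 p).
move: (`|s|) (`|d X l u|) (`|u|) (`|p|) (`|y|) (`|b|) => ns nd nu np ny nb.
move=> s0 d0 p0 en uU uy ub.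
have u1 : nu <= c * (ns + nd) by lra.
pose m := (c + 1) * M.
have m0 : 0 <= m by rewrite mulr_ge0 // addr_ge0.
(* The 3 comes from (a + b + c)^2 <= 3 (a^2 + b^2 + c^2), one factor [c + 1] from bounding [nu + np]
   on the right. Adding [nu] to the left costs the second factor [c + 1]. *)
have : ns + nd + np <= 3 * m.
  apply: sqr_le_mul_le; first by rewrite mulr_ge0.
  have h1 : M * nu <= M * (c * (ns + nd)) by rewrite ler_wpM2l.
  have h2 : 0 <= M * c * np by rewrite !mulr_ge0.
  have h3 : 0 <= M * (ns + nd) by rewrite mulr_ge0 ?addr_ge0.
  have := sqr_ge0 (ns - nd); have := sqr_ge0 (ns - np); have := sqr_ge0 (nd - np).
  rewrite !sqrrB /m !expr2 in en *; lra.
move=> h1; have h2 : c * (ns + nd) <= c * (3 * m).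
  by rewrite ler_wpM2l //; lra.
rewrite /m in h1 h2 *; rewrite expr2; lra.
Qed.

Lemma mixed_solution_bound i j l c g s u p : j = i + 1 -> l = j + 1 ->
  0 <= c -> poincare S i j c -> poincare S j l c ->
  mixed_solution S i j l g s u p ->
  `|s| + `|d X l u| + `|u| + `|p| <= 3 * (c + 1) ^+ 2 * `|g|.
Proof.
move=> eij ejl c0 hP hP' sol; have [[Ss Su Hp] [e1 _ e3]] := sol.
apply: (mixed_solution_stable eij ejl c0 hP hP') => //.
rewrite (mixed_solution_energy eij ejl sol).
by apply: le_trans (inner_le _ _) _; rewrite ler_wpM2l // ler_normD.
Qed.

End Subcomplex.

(** Density of V makes the adjoint single-valued, so [xget] returns the only candidate. *)
Lemma dstarE i j (w : X j) (z : X i) : is_dstar w z -> dstar i w = z.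
Proof.
move=> wz; apply: xget_unique => // z' wz'.
apply/eqP; rewrite -subr_eq0 -normr_le0; apply/ler_addgt0Pr => e e0; rewrite add0r.
set a := z' - z.
have [|v [av Vv]] := V_dense R X i _ _ (ball_open a e).
  by exists a; exact: ballxx.
move: av; rewrite -ball_normE /= => av.
apply: sqr_le_mul_le; first exact: ltW.
rewrite -innerxx.
have -> : <|a, a|> = <|a - v, a|>.
  by rewrite innerBl /a (innerBr v) -wz // -wz' // subrr subr0.
by apply: le_trans (inner_le _ _) _; rewrite ler_wpM2r // ltW.
Qed.

Lemma poincareV i j : compactness_property X -> j = i + 1 ->
  exists2 c, 0 <= c & poincare (V X) i j c.
Proof.
move=> compX eij; subst j.
(* The unit vectors chosen below have squared intersection norm at most 1 + 1 + 1 < 2^2. *)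
have [_ /(_ 2)] := compX i; set A := (X in precompact X) => compA.
have Vsub := V_subspace R X i.
have lind : linear_on (V X i) (d X (i + 1)) by apply: d_linear.
apply: contrapT => nP.
have /boolp.choice[v_ hv] (n : nat) : exists v, [/\ V X i v,
    orthogonal_to (cycles (V X) i (i + 1)) v, `|v| = 1 & `|d X (i + 1) v| <= n.+1%:R^-1].
  apply: contrapT => nv; apply: nP; exists n.+1%:R => // v Vv vZ.
  have [->|v0] := eqVneq v 0; first by rewrite normr0 mulr_ge0.
  have nv0 : 0 < `|v| by rewrite normr_gt0.
  rewrite leNgt; apply/negP => lt; apply: nv; exists (`|v|^-1 *: v); split.
  - exact: subspaceZ.
  - by move=> z Zz; rewrite innerZl vZ // mulr0.
  - by rewrite normrZ ger0_norm ?invr_ge0 // mulVf // gt_eqF.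
  - rewrite (linear_onZ Vsub lind) // normrZ ger0_norm ?invr_ge0 //.
    by rewrite ler_pdivrMl // ler_pdivlMr ?ltr0n // mulrC ltW.
have vA n : A (v_ n).
  (* Orthogonality to the cycles includes orthogonality to the boundaries: [v_ n] lies in the domain
     of the adjoint, which vanishes there. *)
  have [Vv vZ v1 dv] := hv n; have d0 : is_dstar (v_ n) (0 : X (i - 1)).
    move=> w Vw; rewrite inner0r innerC vZ //; split; first by apply: d_dom; rewrite ?subrK.
    by apply: (d_d R X (i - 1)); rewrite ?subrK.
  split=> //; first by exists 0.

  have d2 : `|d X (i + 1) (v_ n)| ^+ 2 <= 1.
    rewrite expr_le1 // (le_trans dv) // invf_le1 ?ler1n //.
  rewrite /normVVstar /normV /normVstar (dstarE d0) v1 normr0 expr1n expr0n /= addr0.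
  rewrite !sqr_sqrtr ?addr_ge0 ?sqr_ge0 ?ler01 //.
  rewrite -[leRHS]ger0_norm ?ler0n // -sqrtr_sqr ler_sqrt ?sqr_ge0 // expr2; lra.
have [v [_ clv]] : closure A `&` cluster (v_ @ \oo) !=set0.
  move: compA; rewrite precompactE; apply.
  by exists 0%N => // n _; apply: subset_closure.
have near (e : R) (N : nat) : 0 < e -> exists2 n, (N <= n)%N & `|v - v_ n| < e.
  move=> e0; have [|y [[n Nn <-] vy]] := clv [set v_ n | n in [set n | (N <= n)%N]]
    (ball v e) _ (nbhsx_ballx _ _ e0).
    by exists N => // n Nn; exists n.
  by exists n => //; move: vy; rewrite -ball_normE.
have vZ z : cycles (V X) i (i + 1) z -> <|v, z|> = 0.
  move=> Zz; apply/eqP; rewrite -normr_le0; apply/ler_addgt0Pr => e e0; rewrite add0r.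
  have z1 : 0 < `|z| + 1 by rewrite ltr_wpDl.
  have [n _ vn] := near (e / (`|z| + 1)) 0 (divr_gt0 e0 z1).
  have [_ vnZ _ _] := hv n.
  have -> : <|v, z|> = <|v - v_ n, z|> by rewrite innerBl vnZ // subr0.
  apply: le_trans (inner_norm _ _) _.
  move: vn; rewrite ltr_pdivlMr // => vn; apply: le_trans (ltW vn).
  by rewrite ler_wpM2l // lerDl.
have [Vv dv] : V X i v /\ d X (i + 1) v = 0.
  apply: closed_graph => // e e0.
  have [N _ hN] := near_infty_natSinv_lt (PosNum e0).
  have [n Nn vn] := near e N e0; have [Vn _ _ dn] := hv n.
  exists (v_ n) => //; split=> //; rewrite sub0r normrN (le_lt_trans dn) //.
  exact: hN.
have v0 : v = 0 by apply/eqP; rewrite -normr_eq0 -sqrf_eq0 -innerxx vZ.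
have [|n _] := near 1 0%N; first exact: ltr01.
by have [_ _ v1 _] := hv n; rewrite v0 sub0r normrN v1 ltxx.
Qed.

(** Let [z] be the lift of [d v] orthogonal to the continuous cycles. Then [v - pi z] is a discrete
    cycle, so |v|^2 = <v, pi z>, and [z] obeys the continuous inequality. The subcomplex enters the
    constant through [c'] only. *)
Lemma poincare_projection (S : forall j, set (X j)) (pi : forall j, X j -> X j)
    i j c c' : subcomplex S -> cochain_projection S pi -> j = i + 1 ->
  0 <= c -> 0 <= c' -> poincare (V X) i j c ->
  (forall x, V X i x -> `|pi i x| <= c' * `|x|) ->
  poincare S i j (c' * c).
Proof.
move=> hS [linpi impi idpi dpi] eij c0 c'0 hP bpi v Sv vZ.
have [subS SV _ _] := hS.
have Bv : boundaries (V X) i j (d X j v) by exists v => //; apply: SV.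
have [z [Vz zZ dz]] := boundary_lift subcomplexV eij Bv.
have Spz : S i (pi i z) by rewrite -impi; exists z.
have dpz : d X j (pi i z) = d X j v.
  rewrite (dpi i) // dz -(dpi i) //; last exact: SV.
  have : S i v := Sv; rewrite -impi => -[w Vw <-].
  by rewrite idpi.
apply: sqr_le_mul_le; first by rewrite !mulr_ge0.
have -> : `|v| ^+ 2 = <|v, pi i z|>.
  rewrite -innerxx; apply/eqP; rewrite -subr_eq0 -innerBr vZ //.
  split; first exact: subspaceB.
  by rewrite (linear_onB (subS i) (sub_d_linear hS eij)) // dpz subrr.
apply: le_trans (inner_le _ _) _; rewrite mulrC ler_wpM2r //.
apply: le_trans (bpi _ Vz) _; rewrite -mulrA ler_wpM2l // -dz.
exact: hP.
Qed.

End Subcomplexes.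
Arguments cycles {R X} S i j.
Arguments boundaries {R X} S i j.
Arguments harmonics {R X} S i j l.
Arguments poincare {R X} S i j c.
Arguments mixed_solution {R X} S i j l g s u p.

(** * The solution operator and the error coefficients *)

Section SolutionOperator.
Context {R : realType} (X : hilbert_complex R).
Hypothesis compX : compactness_property X.
Variables (i j l : int).
Hypotheses (eij : j = i + 1) (ejl : l = j + 1).
Implicit Type g : X j.

Lemma mixed_solutionV_bound : exists2 C, 0 <= C & forall g s u p,
  mixed_solution (V X) i j l g s u p ->
  `|s| + `|d X l u| + `|u| + `|p| <= C * `|g|.
Proof.
have [c c0 hP] := poincareV compX eij; have [c' c'0 hP'] := poincareV compX ejl.
have m0 : 0 <= Num.max c c' by rewrite le_max c0.
exists (3 * (Num.max c c' + 1) ^+ 2).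
  by rewrite mulr_ge0 // exprn_ge0 // addr_ge0.
move=> g s u p sol; apply: mixed_solution_bound sol => //.
- exact: subcomplexV.
- by apply: poincareW hP; rewrite le_max lexx.
- by apply: poincareW hP'; rewrite le_max lexx orbT.
Qed.

Lemma mixed_solutionV_unique g s u p s' u' p' :
  mixed_solution (V X) i j l g s u p -> mixed_solution (V X) i j l g s' u' p' ->
  s = s' /\ u = u'.
Proof.
move=> sol sol'; have [C C0 hC] := mixed_solutionV_bound.
have := hC _ _ _ _ (mixed_solution_lin (subcomplexV X) (-1) eij ejl sol sol').
rewrite !scaleN1r (addrC (- g)) subrr normr0 mulr0 => h.
have [[[ns nd] nu] np] := (normr_ge0 (- s + s'), normr_ge0 (d X l (- u + u')),
  normr_ge0 (- u + u'), normr_ge0 (- p + p')).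
split; apply/eqP; rewrite eq_sym -subr_eq0 addrC -normr_eq0 eq_le normr_ge0 andbT; lra.
Qed.

(** The first equation says that [s] is the adjoint differential of [u], so [K g] determines
    both. *)
Lemma K_spec g :
  exists p, mixed_solution (V X) i j l g (dstar i (K g)) (K g) p.
Proof.
have [c c0 hP] := poincareV compX eij; have [c' c'0 hP'] := poincareV compX ejl.
have [s [u [p sol]]] := mixed_solution_exists (subcomplexV X) g eij ejl c0 c'0 hP hP'.
have ei : i = j - 1 by rewrite eij addrK.
subst i l.
have [s' [p' sol']] : exists s p, linear_solution g s (K g) p.
  by apply: (@xgetPex _ 0 [set u | exists s p, linear_solution g s u p]); exists u, s, p.
rewrite (@dstarE _ _ _ _ (K g) s'); first by exists p'.
have [_ [e1 _ _]] := sol' => v Vv; rewrite innerC (innerC v); have := e1 v Vv; lra.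
Qed.

Lemma K_eq g s u p :
  mixed_solution (V X) i j l g s u p -> K g = u /\ dstar i (K g) = s.
Proof.
move=> sol; have [p' sol'] := K_spec g.
by have [-> ->] := mixed_solutionV_unique sol' sol.
Qed.

Lemma KZ (a : R) g :
  K (a *: g) = a *: K g /\ dstar i (K (a *: g)) = a *: dstar i (K g).
Proof.
have [p sol] := K_spec g.
(* Writing [a *: g] as [(a - 1) *: g + g] lets one solution serve for both terms. *)
have := mixed_solution_lin (subcomplexV X) (a - 1) eij ejl sol sol.
by rewrite !scalerBl !scale1r !subrK => /K_eq.
Qed.

Lemma K_bound : exists2 C, 0 <= C & forall g,
  [/\ `|K g| <= C * `|g|, `|d X l (K g)| <= C * `|g| & `|dstar i (K g)| <= C * `|g|].
Proof.
have [C C0 hC] := mixed_solutionV_bound; exists C => // g.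
have [p /hC] := K_spec g.
have [[[ns nd] nu] np] := (normr_ge0 (dstar i (K g)), normr_ge0 (d X l (K g)),
  normr_ge0 (K g), normr_ge0 p).
by split; lra.
Qed.

End SolutionOperator.

(** * Projection errors and quasi-optimality *)

Section Projection.
Context {R : realType} (X : hilbert_complex R).
Variables (S : forall j, set (X j)) (pi : forall j, X j -> X j) (c : int -> R).
Hypotheses (hS : subcomplex S) (hpi : cochain_projection S pi).
Hypotheses (c_ge0 : forall j, 0 <= c j).
Hypothesis bpi : forall j x, V X j x -> `|pi x| <= c j * `|x|.

Lemma defectE j (x : X j) : V X j x -> defect pi x = x - pi x.
Proof.
move=> Vx; rewrite /defect (dense_extensionE (V_subspace R X j) _ (bpi (j := j))) //.
by case: hpi.
Qed.

Lemma projection_error j (x : X j) : V X j x -> `|x - pi x| <= (1 + c j) * `|x|.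
Proof.
move=> Vx; apply: le_trans (ler_normB _ _) _; rewrite mulrDl mul1r lerD2l.
exact: bpi.
Qed.

(** [I - pi] vanishes on [S], so it may be applied to [x - y] for any discrete [y]. *)
Lemma projection_best_approx j (x : X j) : V X j x ->
  `|x - pi x| <= (1 + c j) * best_approx (@S j) x.
Proof.
have [subS SV _ _] := hS; have [linpi impi idpi _] := hpi.
move=> Vx; apply: (le_best_approx (subS j)); first by rewrite addr_ge0.
move=> y Sy; have Vy := SV j y Sy.
have -> : x - pi x = (x - y) - pi (x - y).
  rewrite (linear_onB (V_subspace R X j) (linpi j)) //.
  have -> : pi y = y by move: Sy; rewrite -impi => -[z Vz <-]; exact: idpi.
  by rewrite opprB addrA subrK.
by apply: projection_error; apply: subspaceB => //; exact: V_subspace.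
Qed.

Lemma opnorm_defect i j (f : X i -> X j) (C : R) : 0 <= C ->
  (forall a x, f (a *: x) = a *: f x) -> (forall x, V X j (f x)) ->
  (forall x, `|f x| <= C * `|x|) ->
  let N := opnorm (fun x => defect pi (f x)) in
  [/\ 0 <= N, N <= (1 + c j) * C & forall x, `|f x - pi (f x)| <= N * `|x|].
Proof.
move=> C0 fZ Vf hf N; have [linpi _ _ _] := hpi.
have b x : `|defect pi (f x)| <= (1 + c j) * C * `|x|.
  rewrite defectE // (le_trans (projection_error (Vf x))) // -mulrA ler_wpM2l //.
  by rewrite addr_ge0.
have C1 : 0 <= (1 + c j) * C by rewrite mulr_ge0 // addr_ge0.
split=> [||x]; [exact: opnorm_ge0 C1 b|exact: opnorm_le|].
rewrite -defectE //; apply: (@le_opnorm _ _ _ (fun x => defect pi (f x)) _ x C1) => // a y.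
rewrite !defectE //.
by rewrite fZ (linear_onZ (V_subspace R X j) (linpi j)) // scalerBr.
Qed.

End Projection.

(** * Orthogonal projection onto the harmonic forms *)

Section HarmonicProjection.
Context {R : realType} (X : hilbert_complex R).
Hypothesis compX : compactness_property X.
Variables (i j l : int).
Hypotheses (eij : j = i + 1) (ejl : l = j + 1).

Lemma harmonics_subspace : linear_subspace (harmonics (V X) i j l).
Proof.
have sV := V_subspace R X j.
have Zs := cycles_subspace (subcomplexV X) ejl.
split=> [|a x y [Vx dx xB] [Vy dy yB]].
  by have [V0 d0] := subspace0 Zs; split=> // y _; rewrite inner0l.
have [Vz dz] := Zs.2 a x y (conj Vx dx) (conj Vy dy).
by split=> // t Vt; rewrite innerDl innerZl xB // yB // mulr0 addr0.
Qed.

Lemma harmonic_projection x :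
  exists2 h, harmonics (V X) i j l h &
    forall q, harmonics (V X) i j l q -> <|x - h, q|> = 0.
Proof.
have [c c0 hP] := poincareV compX eij.
have [b [h [y [-> Bb Hh yZ]]]] := hodge_decomposition (subcomplexV X) x eij ejl c0 hP.
exists h => // q Hq.
rewrite innerBl !innerDl yZ; last exact: harmonics_cycles Hq.
by rewrite (innerC b) (harmonics_boundaries Hq) // add0r addr0 subrr.
Qed.

Lemma orth_proj_harmonicsE x h : harmonics (V X) i j l h ->
  (forall q, harmonics (V X) i j l q -> <|x - h, q|> = 0) ->
  orth_proj (harmonics (V X) i j l) x = h.
Proof. exact: orth_projE harmonics_subspace _ _. Qed.

Lemma orth_proj_harmonicsP x : let h := orth_proj (harmonics (V X) i j l) x in
  harmonics (V X) i j l h /\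
  forall q, harmonics (V X) i j l q -> <|x - h, q|> = 0.
Proof. by have [h Hh hx] := harmonic_projection x; rewrite (orth_proj_harmonicsE Hh). Qed.

Lemma orth_proj_harmonicsZ (a : R) x :
  orth_proj (harmonics (V X) i j l) (a *: x) = a *: orth_proj (harmonics (V X) i j l) x.
Proof.
have [Hh hx] := orth_proj_harmonicsP x.
apply: orth_proj_harmonicsE => [|q Hq]; first exact: subspaceZ harmonics_subspace _ _ _.
by rewrite -scalerBr innerZl hx // mulr0.
Qed.

Lemma orth_proj_harmonics_norm x : `|orth_proj (harmonics (V X) i j l) x| <= `|x|.
Proof.
have [Hh hx] := orth_proj_harmonicsP x; set h := orth_proj _ x in Hh hx *.
apply: sqr_le_mul_le => //; rewrite -innerxx.
suff -> : <|h, h|> = <|x, h|> by exact: inner_le.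
by have := hx _ Hh; rewrite innerBl; lra.
Qed.

End HarmonicProjection.

(** * Projection errors measured by delta, eta and mu *)

Section ErrorCoefficients.
Context {R : realType} (X : hilbert_complex R).
Hypothesis compX : compactness_property X.
Variables (i j l : int).
Hypotheses (eij : j = i + 1) (ejl : l = j + 1).

(** [C] is fixed before the subcomplex and the projection, which makes the coefficients uniformly
    bounded in [h]. *)
Lemma projected_solution_bound : exists2 C, 0 <= C &
  forall S pi (c : int -> R), subcomplex S -> cochain_projection S pi ->
  (forall n, 0 <= c n) -> (forall n x, V X n x -> `|pi n x| <= c n * `|x|) ->
  [/\ 0 <= delta pi j <= (1 + c j) * C,
      0 <= norm_dK pi j l <= (1 + c l) * C,
      0 <= norm_dstarK pi i j <= (1 + c i) * C &
      forall g s u p, mixed_solution (V X) i j l g s u p ->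
        [/\ `|u - pi j u| <= delta pi j * `|g|,
            `|d X l u - pi l (d X l u)| <= norm_dK pi j l * `|g| &
            `|s - pi i s| <= norm_dstarK pi i j * `|g|]].
Proof.
have [C C0 hC] := K_bound compX eij ejl; exists C => // S pi c hS hpi c0 bpi.
have Ks (g : X j) : V X i (dstar i (K g)) /\ V X j (K g).
  by have [p [[]]] := K_spec compX eij ejl g.
have dKZ a (g : X j) : d X l (K (a *: g)) = a *: d X l (K g).
  rewrite (KZ compX eij ejl a g).1 (linear_onZ (V_subspace R X j)) //; last by case: (Ks g).
  exact: d_linear.
have [a1 b1 h1] := opnorm_defect hpi c0 bpi C0 (fun a g => (KZ compX eij ejl a g).1)
  (fun g => (Ks g).2) (fun g => let: And3 h _ _ := hC g in h).
have [a2 b2 h2] := opnorm_defect hpi c0 bpi C0 dKZ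
  (fun g => sub_d (subcomplexV X) ejl (Ks g).2) (fun g => let: And3 _ h _ := hC g in h).
have [a3 b3 h3] := opnorm_defect hpi c0 bpi C0 (fun a g => (KZ compX eij ejl a g).2)
  (fun g => (Ks g).1) (fun g => let: And3 _ _ h := hC g in h).
split; [exact/andP|exact/andP|exact/andP|] => g s u p /(K_eq compX eij ejl)[<- <-].
by split; [exact: h1|exact: h2|exact: h3].
Qed.

(** The form [k] is a solution in two ways: [k = K (d y)] in degree j, with [y] as its stress, and
    [k = d r] with [r = K y] in degree i. The first reading bounds its projection error by delta |d
    y|, as [solution_error] requires, the second by eta |y|, as [stress_error] requires. *)
Lemma dual_potential y : V X i y -> orthogonal_to (cycles (V X) i j) y ->
  exists k r, [/\ boundaries (V X) i j k, d X j r = k,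
    forall t, V X i t -> <|k, d X j t|> = <|y, t|>,
    mixed_solution (V X) i j l (d X j y) y k 0 &
    forall h, i = h + 1 -> mixed_solution (V X) h i j y 0 r 0].
Proof.
move=> Vy yZ; have sV := subcomplexV X; have VS n := V_subspace R X n.
have [c c0 hP] := poincareV compX eij.
have [k Bk hk] := coboundary_dual sV eij c0 hP yZ.
have [r [Vr rZ dr]] := boundary_lift sV eij Bk.
have [Vk dk] := boundaries_cycles sV eij ejl Bk.
have lind n n' (e : n' = n + 1) : linear_on (V X n) (d X n') by exact: d_linear.
have harm0 n n' n'' (e : n'' = n' + 1) : harmonics (V X) n n' n'' 0.
  split; [exact: (subspace0 (VS n'))|exact: (linear_on0 (VS n') (lind _ _ e))|].
  by move=> t _; rewrite inner0l.
exists k, r; split=> //.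
- split; first by split=> //; exact: harm0.
  split=> [t Vt|v Vv|q Hq]; first by rewrite hk ?subrr.
  + by rewrite dk !inner0l !addr0.
  + by rewrite innerC (harmonics_boundaries Hq).
- move=> h e; split; first by split=> //; [exact: (subspace0 (VS h))|exact: harm0].
  split=> [t Vt|v Vv|q Hq].
  + rewrite inner0l rZ ?subrr //; apply: (boundaries_cycles sV e eij); exists t => //.
  + by rewrite (linear_on0 (VS h) (lind _ _ e)) !inner0l add0r addr0 dr hk.
  + by rewrite rZ //; exact: harmonics_cycles Hq.
Qed.

Lemma projected_harmonic_bound S pi (c : int -> R) :
  subcomplex S -> cochain_projection S pi ->
  (forall n, 0 <= c n) -> (forall n x, V X n x -> `|pi n x| <= c n * `|x|) ->
  let N := opnorm (fun x => defect pi (orth_proj (harmonics (V X) i j l) x)) in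
  0 <= N <= 1 + c j /\ forall x h, harmonics (V X) i j l h ->
    (forall q, harmonics (V X) i j l q -> <|x - h, q|> = 0) -> `|h - pi j h| <= N * `|x|.
Proof.
move=> hS hpi c0 bpi N.
have [a b hN] := opnorm_defect hpi c0 bpi ler01 (orth_proj_harmonicsZ compX eij ejl)
  (fun x => let: And3 h _ _ := (orth_proj_harmonicsP compX eij ejl x).1 in h)
  (fun x => eq_ind_r (fun y => _ <= y) (orth_proj_harmonics_norm compX eij ejl x) (mul1r _)).
rewrite mulr1 in b; split; first exact/andP.
by move=> x h Hh hx; have := hN x; rewrite (orth_proj_harmonicsE ejl Hh hx).
Qed.

End ErrorCoefficients.

(** * Cochain projections *)

Section CochainProjection.
Context {R : realType} (X : hilbert_complex R).
Variables (S : forall j, set (X j)) (pi : forall j, X j -> X j).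
Hypotheses (hS : subcomplex S) (hpi : cochain_projection S pi).

Lemma projection_mem j (x : X j) : V X j x -> S (pi x).
Proof. by case: hpi => _ <- _ _ Vx; exists x. Qed.

Lemma projection_id j (x : X j) : S x -> pi x = x.
Proof. by case: hpi => _ <- h _ [y Vy <-]; exact: h. Qed.

Lemma projection_d i j (x : X i) : j = i + 1 -> V X i x -> d X j (pi x) = pi (d X j x).
Proof. by case: hpi => _ _ _ h e Vx; exact: h. Qed.

Lemma projection_boundaries i j (b : X j) : j = i + 1 ->
  boundaries (V X) i j b -> boundaries S i j (pi b).
Proof.
by move=> e [x Vx <-]; exists (pi x); [exact: projection_mem|exact: projection_d].
Qed.

Lemma sub_cycles i j (x : X i) : cycles S i j x -> cycles (V X) i j x.
Proof. by case: hS => _ SV _ _ [Sx dx]; split=> //; exact: SV. Qed.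

Lemma sub_boundaries i j (x : X j) : boundaries S i j x -> boundaries (V X) i j x.
Proof. by case: hS => _ SV _ _ [y Sy <-]; exists y => //; exact: SV. Qed.

(* pi y' - y is a discrete cycle, and both y and y' are orthogonal to these. *)
Lemma continuous_lift i j (y : X i) : j = i + 1 ->
  S y -> orthogonal_to (cycles S i j) y ->
  exists y', [/\ V X i y', orthogonal_to (cycles (V X) i j) y', d X j y' = d X j y &
    `|y - y'| <= `|y' - pi y'|].
Proof.
move=> e Sy yZ; have [subS SV _ _] := hS.
have By : boundaries (V X) i j (d X j y) by exists y => //; exact: SV.
have [y' [Vy' y'Z dy']] := boundary_lift (subcomplexV X) e By.
exists y'; split=> //.
have Z : cycles S i j (y - pi y').
  split; first by apply: subspaceB => //; exact: projection_mem.
  rewrite (linear_onB (subS i) (sub_d_linear hS e)) //; last exact: projection_mem.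
  by rewrite projection_d // dy' projection_id ?subrr //; exact: (sub_d hS).
apply: sqr_le_mul_le => //.
have -> : `|y - y'| ^+ 2 = <|pi y' - y', y - y'|>.
  rewrite -innerxx; apply/eqP; rewrite -subr_eq0 -innerBl; apply/eqP.
  have -> : y - y' - (pi y' - y') = y - pi y' by rewrite opprB addrA subrK.
  rewrite innerBr (innerC _ y) yZ // (innerC _ y') y'Z ?subrr //.
  exact: sub_cycles.
by rewrite (distrC y') inner_le.
Qed.

(* A discrete harmonic form is orthogonal to pi of its boundary part. *)
Lemma harmonic_gap i j l c (q : X j) : j = i + 1 -> l = j + 1 ->
  0 <= c -> poincare (V X) i j c -> harmonics S i j l q ->
  exists h b, [/\ q = h + b, harmonics (V X) i j l h, boundaries (V X) i j b,
    forall r, harmonics (V X) i j l r -> <|q - h, r|> = 0 & `|b| <= `|h - pi h|].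
Proof.
move=> eij ejl c0 hP Hq; have [Sq dq qB] := Hq; have [subS SV _ _] := hS.
have sV := subcomplexV X.
have [b [h [y [eq Bb Hh yZ]]]] := hodge_decomposition sV q eij ejl c0 hP.
have Zb := boundaries_cycles sV eij ejl Bb.
have y0 : y = 0.
  have Zy : cycles (V X) j l y.
    have -> : y = q - b - h by rewrite eq -(addrA b) [b + _]addrC addrK [h + _]addrC addrK.
    have ZV := cycles_subspace sV ejl.
    apply: (subspaceB ZV); last exact: harmonics_cycles Hh.
    apply: (subspaceB ZV) => //; exact: sub_cycles (harmonics_cycles Hq).
  by apply/eqP; rewrite -normr_eq0 -sqrf_eq0 -innerxx yZ.
rewrite y0 addr0 addrC in eq.
have eb : q - h = b by rewrite eq addrAC subrr add0r.
exists h, b; split=> //.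
  by move=> r Hr; rewrite eb innerC (harmonics_boundaries Hr).
have Vb : V X j b by case: Zb.
have Vh : V X j h by case: Hh.
apply: sqr_le_mul_le => //.
have -> : `|b| ^+ 2 = <|pi h - h, b|>.
  have pib := projection_boundaries eij Bb.
  have : <|pi b, b|> = 0.
    rewrite -{2}eb innerBr innerC (harmonics_boundaries Hq) // innerC.
    by rewrite (harmonics_boundaries Hh) ?subrr //; exact: sub_boundaries.
  have [linpi _ _ _] := hpi.
  have -> : pi b = b - (pi h - h).
    rewrite -[in LHS]eb (linear_onB (V_subspace R X j) (linpi j)) //; last exact: SV.
    by rewrite projection_id // opprB addrA eq; congr (_ - _); rewrite addrC.
  by rewrite innerBl innerxx; lra.
by rewrite (distrC h) inner_le.
Qed.

End CochainProjection.

(** * Linear error estimates *)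

Lemma subrBB {V : zmodType} (x y z : V) : x - y - (x - z) = z - y.
Proof. by rewrite opprB addrC addrA subrK. Qed.

(** For estimates in which the unknown error also occurs on the right. The sharp constant is 1 +
    sqrt 2; 3 avoids the root. *)
Lemma quadratic_absorb {R : realDomainType} (t a : R) : 0 <= a ->
  t ^+ 2 <= 2 * a * t + a ^+ 2 -> t <= 3 * a.
Proof.
move=> a0 h; have [//|lt] := leP t (3 * a).
have h1 : 0 < (t - 3 * a) * t by apply: mulr_gt0; lra.
have h2 : a * (3 * a) <= a * t by rewrite ler_wpM2l // ltW.
have h3 := sqr_ge0 a; rewrite !expr2 in h h3; lra.
Qed.

Section LinearEstimates.
Context {R : realType} (X : hilbert_complex R).
Variables (S : forall j, set (X j)) (pi : forall j, X j -> X j).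
Hypotheses (hS : subcomplex S) (hpi : cochain_projection S pi).
Variables (i j l : int).
Hypotheses (eij : j = i + 1) (ejl : l = j + 1).
(** [M] serves both as Poincare constant of the subcomplex and as quasi-optimality constant of [pi];
    [et], [de] and [m] stand for eta, delta and mu, known only through the bounds assumed below. *)
Variables (M et de m c : R).
Hypotheses (M_ge1 : 1 <= M) (et_ge0 : 0 <= et) (de_ge0 : 0 <= de) (m_ge0 : 0 <= m).
Hypotheses (PSij : poincare S i j M) (PSjl : poincare S j l M).
Hypotheses (c_ge0 : 0 <= c) (PV : poincare (V X) i j c).

Let E n (x : X n) := best_approx (@S n) x.

Hypothesis approx_i : forall x, V X i x -> `|x - pi x| <= M * E x.
Hypothesis approx_j : forall x, V X j x -> `|x - pi x| <= M * E x.
Hypothesis approx_l : forall x, V X l x -> `|x - pi x| <= M * E x.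

(* y = d^* K (d y) and k = K (d y) = d K y. *)
Hypothesis dual_i : forall y, V X i y -> orthogonal_to (cycles (V X) i j) y ->
  exists k, [/\ boundaries (V X) i j k,
    forall t, V X i t -> <|k, d X j t|> = <|y, t|>,
    `|k - pi k| <= de * `|d X j y|, `|k - pi k| <= et * `|y| &
    `|y - pi y| <= et * `|d X j y|].
Hypothesis dual_j : forall y, V X j y -> orthogonal_to (cycles (V X) j l) y ->
  `|y - pi y| <= et * `|d X l y|.
Hypothesis harmonic_proj : forall x h, harmonics (V X) i j l h ->
  (forall q, harmonics (V X) i j l q -> <|x - h, q|> = 0) -> `|h - pi h| <= m * `|x|.

Variables (g : X j) (s : X i) (u p : X j) (s' : X i) (u' p' : X j).
Hypotheses (sol : mixed_solution (V X) i j l g s u p)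
  (sol' : mixed_solution S i j l g s' u' p').

Let subS n : linear_subspace (@S n). Proof. by case: hS. Qed.
Let SV n : @S n `<=` V X n. Proof. by case: hS. Qed.
Let subV := V_subspace R X.
Let linV n n' (e : n' = n + 1) : linear_on (V X n) (d X n') := d_linear R X n n' e.
Let M_ge0 : 0 <= M := le_trans ler01 M_ge1.
Let E_ge0 n (x : X n) : 0 <= E x := best_approx_ge0 (subS n) x.

Let ds := d X j s.
Let ds' := d X j s'.
Let D := `|ds - ds'|.

(** Both problems are tested with a discrete boundary: it is a cycle and is orthogonal to [p] and
    [p'], so only the first term survives. *)
Lemma boundary_error_orthogonal b : boundaries S i j b -> <|ds - ds', b|> = 0.
Proof.
have [[Vs Vu [Vp dp pB]] [_ e2 _]] := sol.
have [[Ss' Su' [Sp' dp' p'B]] [_ e2' _]] := sol'.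
move=> [t St <-]; have St' := sub_d hS eij St; have Vt := SV St.
have := e2 _ (SV St'); have := e2' _ St'.
rewrite (sub_dd hS eij ejl St) !inner0r pB // p'B // innerBl /ds /ds'; lra.
Qed.

(** By this orthogonality [ds'] is the best approximation of [ds] among discrete boundaries, and
    [pi ds] is one of them. *)
Lemma boundary_error : D <= M * E ds.
Proof.
have [[Vs _ _] _] := sol; have [[Ss' _ _] _] := sol'.
have Vds : V X j ds by apply: (sub_d (subcomplexV X) eij).
apply: le_trans (approx_j Vds).
apply: sqr_le_mul_le => //; rewrite -innerxx.
have -> : <|ds - ds', ds - ds'|> = <|ds - pi ds, ds - ds'|>.
  rewrite [RHS]innerC; apply/eqP; rewrite -subr_eq0 -innerBr.
  rewrite subrBB boundary_error_orthogonal //; apply: (subspaceB (boundaries_subspace hS eij)).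
    by apply: (projection_boundaries hpi eij); exists s.
  by exists s'.
exact: inner_le.
Qed.

Lemma stress_orthogonal z : cycles S i j z -> <|s - s', z|> = 0.
Proof.
have [_ [e1 _ _]] := sol; have [_ [e1' _ _]] := sol'.
move=> [Sz dz]; have := e1 _ (SV Sz); have := e1' _ Sz.
rewrite dz !inner0r innerBl; lra.
Qed.

Lemma stress_error_dual y' k e : V X i y' -> boundaries (V X) i j k ->
  (forall t, V X i t -> <|k, d X j t|> = <|y', t|>) -> `|k - pi k| <= e ->
  <|s - s', y'|> <= D * e.
Proof.
move=> Vy' Bk hk ke.
have [[Vs _ _] _] := sol; have [[Ss' _ _] _] := sol'; have Vs' := SV Ss'.
rewrite innerC -hk; last exact: subspaceB.
rewrite (linear_onB (subV i) (linV eij)) // innerC.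
have -> : <|d X j s - d X j s', k|> = <|ds - ds', k - pi k|>.
  by rewrite innerBr (@boundary_error_orthogonal (pi k)) ?subr0 //;
    exact: projection_boundaries.
by apply: le_trans (inner_le _ _) _; rewrite ler_wpM2l.
Qed.

(** The error splits as [(s - pi s) + z + (y - y') + y'], with [z] a discrete cycle, hence
    orthogonal to the error, and [y'] the continuous lift of [y]. Approximation bounds the first
    term, the projection error of [y'] the third, duality the last. *)
Lemma stress_error : `|s - s'| <= 6 * M * (E s + et * E ds).
Proof.
have [[Vs _ _] _] := sol; have [[Ss' _ _] _] := sol'; have Vs' := SV Ss'.
have Zsub := cycles_subspace hS eij.
have Sx : S (pi s - s') by apply: subspaceB => //; exact: (projection_mem hpi).
have [z Zz xz] := orthogonal_decomposition Zsub (cycles_closed hS eij) (pi s - s').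
have [Sz dz] := Zz.
set y := pi s - s' - z in xz.
have Sy : S y by exact: subspaceB.
have [y' [Vy' y'Z dy' yy']] := continuous_lift hS hpi eij Sy xz.
have [k [Bk hk _ k_et y'_et]] := dual_i Vy' y'Z.
have bd : `|d X j y'| <= 2 * M * E ds.
  have -> : d X j y' = (ds - ds') - (ds - pi ds).
    rewrite dy' /y; do 2 rewrite (linear_onB (subS i) (sub_d_linear hS eij)) //.
    - by rewrite dz subr0 (projection_d hpi eij) // subrBB.
    - exact: (projection_mem hpi).
  apply: le_trans (ler_normB _ _) _.
  have := approx_j (sub_d (subcomplexV X) eij Vs); have := boundary_error.
  rewrite /D /ds; lra.
have nyx : `|y| <= `|s - s'| + M * E s.
  apply: le_trans (_ : `|pi s - s'| <= _).
    apply: sqr_le_mul_le => //.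
    have -> : `|y| ^+ 2 = <|y, pi s - s'|>.
      by rewrite -[pi s - s'](subrK z) -/y innerDr (xz z) // addr0 innerxx.
    by rewrite mulrC inner_le.
  have -> : pi s - s' = (s - s') - (s - pi s) by rewrite subrBB.
  by apply: le_trans (ler_normB _ _) _; rewrite lerD2l approx_i.
have ny' : `|y'| <= `|s - s'| + M * E s + 2 * M * et * E ds.
  have -> : y' = y - (y - y') by rewrite opprB addrC subrK.
  apply: le_trans (ler_normB _ _) _.
  have := ler_wpM2l et_ge0 bd; lra.
have e1 : <|s - s', y'|> <= D * (et * `|y'|) by exact: stress_error_dual k_et.
have e2 : <|s - s', y - y'|> <= `|s - s'| * (et * (2 * M * E ds)).
  apply: le_trans (inner_le _ _) _; rewrite ler_wpM2l //.
  by have := ler_wpM2l et_ge0 bd; lra.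
have e3 : <|s - s', s - pi s|> <= `|s - s'| * (M * E s).
  by apply: le_trans (inner_le _ _) _; rewrite ler_wpM2l // approx_i.
have e4 : D * (et * `|y'|) <= M * E ds * et * (`|s - s'| + M * E s + 2 * M * et * E ds).
  rewrite mulrA; apply: ler_pM => //; first by rewrite mulr_ge0 // normr_ge0.
  by apply: ler_wpM2r => //; exact: boundary_error.
have eT : `|s - s'| ^+ 2 = <|s - s', s - pi s|> + <|s - s', y - y'|> + <|s - s', y'|>.
  rewrite -innerxx; have := stress_orthogonal Zz; rewrite /y.
  by rewrite !(innerBr (s - s')); lra.
apply: le_trans (_ : 3 * (M * E s + 2 * M * et * E ds) <= _).
  apply: quadratic_absorb; first by rewrite addr_ge0 ?mulr_ge0.
  rewrite eT; move: e1 e2 e3 e4 (normr_ge0 (s - s')) (E_ge0 s) (E_ge0 ds).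
  move: (`|s - s'|) (E s) (E ds) (D * _) => t a b q e1 e2 e3 e4 t0 a0 b0.
  have h1 : 0 <= M * b * et * t by rewrite !mulr_ge0.
  have h2 : 0 <= (M * a) * (M * b * et) by rewrite !mulr_ge0.
  have h3 := sqr_ge0 (M * a); have h4 := sqr_ge0 (M * b * et).
  have h5 : 0 <= (M * a) * t by rewrite !mulr_ge0.
  rewrite !expr2 in h3 h4 *; lra.
have : 0 <= M * et * E ds by rewrite !mulr_ge0.
have : 0 <= M * E s by rewrite mulr_ge0.
lra.
Qed.

(** With [q = h + b] as in [harmonic_gap], [q] is orthogonal to [pi w] and [h] to [w - pi w], so the
    product is <w - pi w, b>, a product of two small factors. This is the source of the terms with
    mu. *)
Lemma boundary_inner_harmonic w q : boundaries (V X) i j w -> harmonics S i j l q ->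
  <|w, q|> <= m * `|w - pi w| * `|q|.
Proof.
move=> Bw Hq.
have [h [b [eq Hh Bb hq bh]]] := harmonic_gap hS hpi eij ejl c_ge0 PV Hq.
have Bpiw := projection_boundaries hpi eij Bw.
have Bw' : boundaries (V X) i j (w - pi w).
  exact: (subspaceB (boundaries_subspace (subcomplexV X) eij) Bw (sub_boundaries hS Bpiw)).
have -> : <|w, q|> = <|w - pi w, b|>.
  have h1 := harmonics_boundaries Hq Bpiw.
  have h2 := harmonics_boundaries Hh Bw'.
  rewrite innerC in h1; rewrite innerC in h2.
  have h3 : <|w - pi w, q|> = <|w, q|> by rewrite innerBl h1 subr0.
  by rewrite -h3 eq innerDr h2 add0r.
apply: le_trans (inner_le _ _) _; rewrite [m * _]mulrC -mulrA ler_wpM2l //.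
exact: le_trans bh (harmonic_proj Hh hq).
Qed.

(** Let [z] be the projection of [p] onto the discrete cycles; [pi p] being such a cycle, |p - z| is
    an approximation error. The difference [p' - z] is discrete harmonic, and testing both problems
    with it leaves <ds, p' - z>. *)
Lemma harmonic_error : `|p - p'| <= M * (E p + m * E ds).
Proof.
have [[Vs Vu Hp] [_ e2 _]] := sol; have [[Ss' Su' Hp'] [_ e2' _]] := sol'.
have [Vp dp pB] := Hp; have [Sp' dp' p'B] := Hp'.
have Zsub := cycles_subspace hS ejl.
have [z Zz pz] := orthogonal_decomposition Zsub (cycles_closed hS ejl) p.
have [Sz dz] := Zz.
have pp : `|p - z| <= M * E p.
  apply: le_trans (approx_j Vp); apply: sqr_le_mul_le => //.
  have -> : `|p - z| ^+ 2 = <|p - z, p - pi p|>.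
    rewrite -innerxx; apply/eqP; rewrite -subr_eq0 -innerBr subrBB pz //.
    apply: (subspaceB Zsub) => //; split; first exact: (projection_mem hpi).
    rewrite (projection_d hpi ejl) // dp (projection_id hpi) //.
    exact: subspace0.
  by rewrite mulrC inner_le.
have Hr : harmonics S i j l (p' - z).
  have [Sr dr] := subspaceB Zsub (conj Sp' dp') Zz; split=> // t St.
  rewrite innerBl p'B // sub0r.
  have -> : <|z, d X j t|> = <|p, d X j t|> - <|p - z, d X j t|>.
    by rewrite innerBl; ring.
  rewrite pB ?pz ?subrr ?oppr0 //; last exact: SV.
  by apply: (boundaries_cycles hS eij ejl); exists t.
have pr : `|p' - z| <= m * (M * E ds).
  have Vds : V X j ds by apply: (sub_d (subcomplexV X) eij).
  apply: le_trans (_ : m * `|ds - pi ds| <= _); last by rewrite ler_wpM2l // approx_j.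
  apply: sqr_le_mul_le; first by rewrite mulr_ge0.
  have [Sr dr rB] := Hr.
  have := e2 _ (SV Sr); have := e2' _ Sr; rewrite dr !inner0r.
  rewrite (innerC (d X j s')) rB // => h1 h2.
  have h3 := pz (p' - z) (conj Sr dr).
  have -> : `|p' - z| ^+ 2 = <|ds, p' - z|>.
    by rewrite -innerxx innerBl; rewrite innerBl in h3; rewrite /ds; lra.
  by apply: boundary_inner_harmonic => //; exists s.
have -> : p - p' = (p - z) - (p' - z) by rewrite opprB addrA subrK.
by apply: le_trans (ler_normB _ _) _; lra.
Qed.

Let du := d X l u.
Let du' := d X l u'.

Lemma projection_error_bound : V X j u ->
  `|d X l (pi u - u')| <= `|du - du'| + M * E du.
Proof.
move=> Vu; have [[_ Su' _] _] := sol'.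
have -> : d X l (pi u - u') = (du - du') - (du - pi du).
  rewrite (linear_onB (subS j) (sub_d_linear hS ejl)) //; last exact: (projection_mem hpi).
  by rewrite (projection_d hpi ejl) // subrBB.
apply: le_trans (ler_normB _ _) _; rewrite lerD2l approx_l //.
exact: (sub_d (subcomplexV X) ejl).
Qed.

Lemma derivative_error :
  `|du - du'| <= 3 * M * (E du + et * E ds + `|p - p'|).
Proof.
have [[Vs Vu Hp] [_ e2 _]] := sol; have [[Ss' Su' Hp'] [_ e2' _]] := sol'.
have [Vp dp pB] := Hp; have [Sp' dp' p'B] := Hp'; have Vu' := SV Su'.
have Zsub := cycles_subspace hS ejl.
have Sx : S (pi u - u') by apply: subspaceB => //; exact: (projection_mem hpi).
have [z Zz xz] := orthogonal_decomposition Zsub (cycles_closed hS ejl) (pi u - u').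
have [Sz dz] := Zz.
set y := pi u - u' - z in xz.
have Sy : S y by exact: subspaceB.
have [y' [Vy' y'Z dy' yy']] := continuous_lift hS hpi ejl Sy xz.
have ydual := dual_j Vy' y'Z; rewrite dy' in ydual.
have dyx : d X l y = d X l (pi u - u').
  by rewrite /y [LHS](linear_onB (subS j) (sub_d_linear hS ejl)) // dz subr0.
have Vdu : V X l du by exact: (sub_d (subcomplexV X) ejl).
have bd : `|d X l y| <= `|du - du'| + M * E du.
  by rewrite dyx; exact: projection_error_bound.
have ny := PSjl Sy xz.
(* Both problems are tested with [y]. Since [ds - ds'] is a cycle and [y'] is orthogonal to cycles,
   [y] may be replaced by [y - y'], which gains the factor [et]. *)
have eq : <|du - du', d X l y|> = - <|ds - ds', y - y'|> - <|p - p', y|>.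
  have := e2 _ (SV Sy); have := e2' _ Sy.
  rewrite (innerBr (ds - ds')) (innerC _ y') y'Z.
    rewrite !innerBl /du /du' /ds /ds'; lra.
  have dd := sub_dd (subcomplexV X) eij ejl.
  apply: (subspaceB (cycles_subspace (subcomplexV X) ejl)).
    by apply: (boundaries_cycles (subcomplexV X) eij ejl); exists s.
  by apply: (boundaries_cycles (subcomplexV X) eij ejl); exists s' => //; apply: SV.
have f1 : - <|ds - ds', y - y'|> <= M * E ds * (et * `|d X l y|).
  rewrite -innerNr; apply: le_trans (inner_le _ _) _; rewrite normrN.
  by apply: ler_pM => //; [exact: boundary_error|exact: le_trans yy' ydual].
have f2 : - <|p - p', y|> <= `|p - p'| * (M * `|d X l y|).
  by rewrite -innerNr; apply: le_trans (inner_le _ _) _; rewrite normrN ler_wpM2l.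
have f3 : <|du - du', du - pi du|> <= `|du - du'| * (M * E du).
  by apply: le_trans (inner_le _ _) _; rewrite ler_wpM2l // approx_l.
have f4 : `|du - du'| ^+ 2 = <|du - du', du - pi du|> + <|du - du', d X l y|>.
  rewrite -innerxx -innerDr dyx; congr (<| _, _ |>).
  rewrite (linear_onB (subS j) (sub_d_linear hS ejl)) //; last exact: (projection_mem hpi).
  by rewrite (projection_d hpi ejl) // addrA subrK.
pose A := M * (E du + et * E ds + `|p - p'|).
have A0 : 0 <= A by rewrite /A !(mulr_ge0, addr_ge0).
suff : `|du - du'| <= 3 * A by rewrite /A; lra.
apply: quadratic_absorb => //; rewrite f4 eq.
have f5 : 0 <= M * E ds * et by rewrite !mulr_ge0.
have f6 : 0 <= `|p - p'| * M by rewrite mulr_ge0.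
have := ler_wpM2l f5 bd; have := ler_wpM2l f6 bd.
have e0 : 0 <= M * E du by rewrite mulr_ge0.
move: f1 f2 f3 e0 (normr_ge0 (du - du')); rewrite /A.
move: (- <|p - p', y|>) (`|p - p'|) f6 => n1 P f6.
move: (`|du - du'|) (E du) (E ds) (`|d X l y|) f5 => t a b q f5 f1 f2 f3 e0 t0 h1 h2.
set e := M * a in f3 e0 h1 h2 *; set k1 := M * b * et in f5 h2; set k2 := P * M in f6 h1.
have -> : M * (a + et * b + P) = e + k1 + k2 by rewrite /e /k1 /k2; ring.
have g1 : 0 <= e * t by rewrite mulr_ge0.
have g2 : 0 <= k1 * t by rewrite mulr_ge0.
have g3 : 0 <= k2 * t by rewrite mulr_ge0.
have g4 : 0 <= k1 * e by rewrite mulr_ge0.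
have g5 : 0 <= k2 * e by rewrite mulr_ge0.
have g6 : 0 <= k1 * k2 by rewrite mulr_ge0.
have := sqr_ge0 e; have := sqr_ge0 k1; have := sqr_ge0 k2.
have f1' : k1 * q = M * b * (et * q) by rewrite /k1; ring.
have f2' : k2 * q = P * (M * q) by rewrite /k2; ring.
rewrite -f1' in f1; rewrite -f2' in f2; rewrite !expr2; lra.
Qed.

(** [w] is the boundary part of [u]. The three discrete Hodge components of [pi u - u'] are treated
    apart: the boundary part by duality, the harmonic part by [boundary_inner_harmonic], the rest by
    the Poincare inequality. *)
Lemma solution_error (w : X j) : boundaries (V X) i j w ->
  (forall b, boundaries (V X) i j b -> <|u - w, b|> = 0) ->
  `|u - u'| <= 3 * M * E u + et * `|s - s'| + M * de * E ds + M * m * E w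
    + M * (`|du - du'| + M * E du).
Proof.
move=> Bw uw.
have [[Vs Vu Hp] [e1 _ e3]] := sol; have [[Ss' Su' Hp'] [e1' _ e3']] := sol'.
have Vu' := SV Su'.
set x := pi u - u'.
have Sx : S x by apply: subspaceB => //; exact: (projection_mem hpi).
have [b [h [y [ex Bb Hh yZ]]]] := hodge_decomposition hS x eij ejl M_ge0 PSij.
have Zb := boundaries_cycles hS eij ejl Bb; have Zh := harmonics_cycles Hh.
have [Sb db] := Zb; have [Sh dh] := Zh.
have ey : y = x - b - h by rewrite ex -(addrA b) [b + _]addrC addrK [h + _]addrC addrK.
have Sy : S y by rewrite ey; do 2 apply: subspaceB => //.
have ny : `|y| <= M * (`|du - du'| + M * E du).
  apply: le_trans (PSjl Sy yZ) _; rewrite ler_wpM2l //.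
  apply: le_trans _ (projection_error_bound Vu); rewrite ey -/x.
  have Sxb : S (x - b) by exact: subspaceB.
  by do 2 rewrite (linear_onB (subS j) (sub_d_linear hS ejl)) //; rewrite db dh !subr0.
have uE : `|pi u - u| <= M * E u by rewrite distrC approx_j.
have nh : `|h| <= M * E u + M * m * E w.
  apply: sqr_le_mul_le; first by rewrite addr_ge0 ?mulr_ge0.
  have -> : `|h| ^+ 2 = <|pi u - u, h|> + <|w, h|>.
    have hx : <|x, h|> = <|h, h|>.
      rewrite ex !innerDl yZ // (innerC b) (harmonics_boundaries Hh) //; ring.
    have u'h := e3' _ Hh.
    (* Up to a boundary, [h] is a continuous harmonic form, to which both [u] and [w] are
       orthogonal; on boundaries [u] and [w] agree. *)
    have uh : <|u, h|> = <|w, h|>.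
      have [q [r [-> Hq Br _ _]]] := harmonic_gap hS hpi eij ejl c_ge0 PV Hh.
      rewrite !innerDr e3 // (innerC w q) (harmonics_boundaries Hq) //.
      by have := uw _ Br; rewrite innerBl; lra.
    by rewrite -innerxx -hx -uh -innerDl subrK /x innerBl u'h subr0.
  have h1 : <|w, h|> <= (M * m * E w) * `|h|.
    apply: le_trans (boundary_inner_harmonic Bw Hh) _; rewrite ler_wpM2r //.
    have Vw : V X j w by case: (boundaries_cycles (subcomplexV X) eij ejl Bw).
    by have := ler_wpM2l m_ge0 (approx_j Vw); lra.
  have h2 : <|pi u - u, h|> <= (M * E u) * `|h|.
    by apply: le_trans (inner_le _ _) _; rewrite ler_wpM2r.
  lra.
have nb : `|b| <= M * E u + et * `|s - s'| + M * de * E ds.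
  apply: sqr_le_mul_le; first by rewrite !(addr_ge0, mulr_ge0).
  have [t [St tZ dt]] := boundary_lift hS eij Bb.
  have [t' [Vt' t'Z dt' tt']] := continuous_lift hS hpi eij St tZ.
  have [k [Bk hk k_de _ t'_et]] := dual_i Vt' t'Z.
  rewrite dt' dt in k_de t'_et.
  (* The first equations of the two problems, tested with the lift [t] of [b], turn <u - u', b> into
     <s - s', t>. *)
  have -> : `|b| ^+ 2 = <|pi u - u, b|> + (<|s - s', t - t'|> + <|s - s', t'|>).
    have hx : <|x, b|> = <|b, b|>.
      by rewrite ex !innerDl yZ // (harmonics_boundaries Hh) //; ring.
    have := e1 _ (SV St); have := e1' _ St; rewrite dt -innerDr subrK.
    rewrite -innerxx -hx /x !innerBl; lra.
  have h1 : <|s - s', t'|> <= D * (de * `|b|) by exact: stress_error_dual k_de.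
  have h2 : <|s - s', t - t'|> <= `|s - s'| * (et * `|b|).
    apply: le_trans (inner_le _ _) _; rewrite ler_wpM2l //.
    exact: le_trans tt' t'_et.
  have h3 : <|pi u - u, b|> <= (M * E u) * `|b|.
    by apply: le_trans (inner_le _ _) _; rewrite ler_wpM2r.
  have h4 : D * (de * `|b|) <= M * E ds * (de * `|b|).
    by rewrite ler_wpM2r ?mulr_ge0 // boundary_error.
  lra.
have -> : u - u' = x - (pi u - u) by rewrite /x subrBB.
apply: le_trans (ler_normB _ _) _.
have : `|x| <= `|b| + `|h| + `|y|.
  rewrite ex; apply: le_trans (ler_normD _ _) _; rewrite lerD2r; exact: ler_normD.
lra.
Qed.


(** The stress error enters multiplied by [et] and contributes [et ^+ 2 * E ds]; one factor is
    replaced by its bound [L]. *)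
Lemma total_error (L : R) (w : X j) : et <= L -> boundaries (V X) i j w ->
  (forall b, boundaries (V X) i j b -> <|u - w, b|> = 0) ->
  `|u - u'| + `|du - du'| + `|p - p'| <=
    (15 * M + 6 * M * L + 7 * M ^+ 2 + 3 * M ^+ 3) *
    (E u + E du + E p + et * (E s + E ds) + (de + m) * E ds + m * E w).
Proof.
move=> etL Bw uw; set Q := (X in _ <= _ * X).
have x1 := E_ge0 u; have x2 := E_ge0 du; have x3 := E_ge0 p.
have x4 := mulr_ge0 et_ge0 (E_ge0 s); have x5 := mulr_ge0 et_ge0 (E_ge0 ds).
have x6 := mulr_ge0 de_ge0 (E_ge0 ds); have x7 := mulr_ge0 m_ge0 (E_ge0 ds).
have x8 := mulr_ge0 m_ge0 (E_ge0 w).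
have Q0 : 0 <= Q by rewrite /Q; lra.
have hP : `|p - p'| <= M * Q.
  by apply: le_trans harmonic_error _; rewrite ler_wpM2l // /Q; lra.
have hD : `|du - du'| <= 3 * M * (Q + M * Q).
  apply: le_trans derivative_error _; rewrite ler_wpM2l ?mulr_ge0 // lerD //.
  by rewrite /Q; lra.
have hT : et * `|s - s'| <= 6 * M * (Q + L * Q).
  apply: le_trans (ler_wpM2l et_ge0 stress_error) _.
  rewrite mulrCA ler_wpM2l ?mulr_ge0 // mulrDr lerD //; first by rewrite /Q; lra.
  by apply: ler_pM => //; rewrite /Q; lra.
have hU := solution_error Bw uw.
have y1 : M * E u <= M * Q by rewrite ler_wpM2l // /Q; lra.
have y2 : M * (de * E ds) <= M * Q by rewrite ler_wpM2l // /Q; lra.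
have y3 : M * (m * E w) <= M * Q by rewrite ler_wpM2l // /Q; lra.
have y4 : M * (`|du - du'| + M * E du) <= M * (3 * M * (Q + M * Q) + M * Q).
  by rewrite ler_wpM2l // lerD // ler_wpM2l // /Q; lra.
rewrite !exprS expr0 !mulr1.
move: hP hD hT hU y1 y2 y3 y4; lra.
Qed.

End LinearEstimates.

(** * The semilinear problem *)

Section Comparison.
Context {R : realType} (X : hilbert_complex R).
Variables (i j l : int).
Hypotheses (eij : j = i + 1) (ejl : l = j + 1).
Variables (F : X j -> X j) (CF : R).
Hypotheses (CF_ge0 : 0 <= CF) (monoF : monotone_op F).
Hypothesis lipF : forall u v, V X j u -> V X j v -> `|F u - F v| <= CF * normV (u - v).

Let subV := V_subspace R X.
Let linV : linear_on (V X j) (d X l) := d_linear R X j l ejl.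

(** [p] and [p'] are cycles and contribute to the V-norm through their W-norm only. *)
Lemma lipschitz_sum u p u' p' : V X j u -> V X j u' ->
  V X j p -> V X j p' -> d X l p = 0 -> d X l p' = 0 ->
  `|F (u + p) - F (u' + p')| <= CF * (`|u - u'| + `|d X l u - d X l u'| + `|p - p'|).
Proof.
move=> Vu Vu' Vp Vp' dp dp'; apply: le_trans (lipF _ _) _; try exact: subspaceD.
rewrite ler_wpM2l // opprD addrACA /normV -ejl.
apply: le_trans (sqrt_sqrD_le _ _) _ => //.
have Vuu := subspaceB (subV j) Vu Vu'; have Vpp := subspaceB (subV j) Vp Vp'.
rewrite (linear_onD linV Vuu Vpp) !(linear_onB (subV j) linV) // dp dp' subrr addr0.
by rewrite [leRHS]addrAC lerD2r ler_normD.
Qed.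

Variables (S : forall n, set (X n)) (M : R).
Hypotheses (hS : subcomplex S) (M_ge0 : 0 <= M).
Hypotheses (PSij : poincare S i j M) (PSjl : poincare S j l M).

(* Monotonicity at the two discrete sums replaces F (u + p) by F (u' + p'). *)
Lemma semilinear_comparison f (s' : X i) u p u' p' (sh : X i) uh ph :
  V X j u -> V X j p -> d X l p = 0 ->
  mixed_solution S i j l (f - F (u + p)) s' u' p' ->
  mixed_solution S i j l (f - F (uh + ph)) sh uh ph ->
  let Y := `|u - u'| + `|d X l u - d X l u'| + `|p - p'| in
  let Z := 3 * (M + 1) ^+ 2 * (CF * Y) in
  `|s' - sh| + `|d X l u' - d X l uh| + `|u' - uh| + `|p' - ph| <= Z /\
  `|d X j s' - d X j sh| <= CF * (Y + Z).
Proof.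
move=> Vu Vp dp sol' solh Y Z; have [subS SV _ _] := hS.
have [[Ss' Su' [Sp' dp' _]] _] := sol'; have [[Ssh Suh [Sph dph _]] _] := solh.
have [Vu' Vp' Vuh Vph] := And4 (SV _ _ Su') (SV _ _ Sp') (SV _ _ Suh) (SV _ _ Sph).
have linS n n' (e : n' = n + 1) := sub_d_linear hS e.
have := mixed_solution_lin hS (-1) eij ejl solh sol'.
rewrite !scaleN1r !(addrC (- _)) subrBB.
set G := F (uh + ph) - F (u + p) => sol.
have Y0 : 0 <= Y by rewrite /Y !addr_ge0.
have stab : `|s' - sh| + `|d X l (u' - uh)| + `|u' - uh| + `|p' - ph| <= Z.
  have [[Sds Sdu Hdp] [e1 _ e3]] := sol.
  apply: (mixed_solution_stable hS eij ejl) => //; first by rewrite mulr_ge0.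
  rewrite (mixed_solution_energy eij ejl sol).
  have -> : u' - uh + (p' - ph) = (u' + p') - (uh + ph) by rewrite opprD addrACA.
  have mono := monoF (subspaceD (subV j) Vu' Vp') (subspaceD (subV j) Vuh Vph).
  have lip := lipschitz_sum Vu Vu' Vp Vp' dp dp'; rewrite -/Y in lip.
  have -> : G = (F (u' + p') - F (u + p)) - (F (u' + p') - F (uh + ph)) by rewrite subrBB.
  rewrite innerBl; apply: le_trans (_ : <|F (u' + p') - F (u + p), u' + p' - (uh + ph)|> <= _).
    lra.
  apply: le_trans (inner_le _ _) _; rewrite distrC; apply: ler_pM => //.
  by rewrite opprD addrACA ler_normD.
have dd : d X l (u' - uh) = d X l u' - d X l uh.
  by rewrite (linear_onB (subS j) (linS _ _ ejl)).
rewrite dd in stab; split=> //.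
rewrite -(linear_onB (subS i) (linS _ _ eij)) //.
(* The differential of [s' - sh] is absent from the energy and is bounded by the data [G], a
   difference of [F] between the exact and the semilinear discrete solution. *)
apply: le_trans (mixed_solution_boundary hS eij ejl sol) _.
rewrite /G distrC.
apply: le_trans (lipschitz_sum Vu Vuh Vp Vph dp dph) _; rewrite ler_wpM2l //.
have t (W : hilbertType R) (x y z : W) : `|x - z| <= `|x - y| + `|y - z|.
  exact: ler_distD.
have := t _ u u' uh; have := t _ (d X l u) (d X l u') (d X l uh); have := t _ p p' ph.
have := normr_ge0 (s' - sh); rewrite /Y; lra.
Qed.

End Comparison.

Lemma semilinear_mixed_solution (R : realType) (X : hilbert_complex R)
    (S : forall j, set (X j)) k (F : X k -> X k) f s u p :
  semilinear_solution S F f s u p ->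
  mixed_solution S (k - 1) k (k + 1) (f - F (u + p)) s u p.
Proof.
move=> [? [e1 e2 e3]]; split=> //; split=> // v Sv.
by rewrite innerBl -e2 //; ring.
Qed.

(** * Linear estimates with constants uniform over all subcomplexes *)

Section Discretization.
Context {R : realType} (X : hilbert_complex R).
Hypothesis compX : compactness_property X.
Variables (c : int -> R) (k : int).
Hypothesis c_ge0 : forall n, 0 <= c n.

Lemma linear_estimates : exists M L, [/\ 1 <= M, 0 <= L &
  forall S pi, subcomplex S -> cochain_projection S pi ->
    (forall n x, V X n x -> `|pi n x| <= c n * `|x|) ->
  let E := fun (n : int) (x : X n) => best_approx (S n) x in
  let et := eta pi k in let de := delta pi k in let m := mu pi k in
  [/\ poincare S (k - 1) k M, poincare S k (k + 1) M,
      [/\ 0 <= et <= L, 0 <= de <= L & 0 <= m <= L] &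
      forall g s u p s' u' p',
        mixed_solution (V X) (k - 1) k (k + 1) g s u p ->
        mixed_solution S (k - 1) k (k + 1) g s' u' p' ->
      [/\ `|d X k s - d X k s'| <= M * E k (d X k s),
          `|s - s'| <= 6 * M * (E (k - 1) s + et * E k (d X k s)) &
          `|u - u'| + `|d X (k + 1) u - d X (k + 1) u'| + `|p - p'| <=
            (15 * M + 6 * M * L + 7 * M ^+ 2 + 3 * M ^+ 3) *
            (E k u + E (k + 1) (d X (k + 1) u) + E k p
             + et * (E (k - 1) s + E k (d X k s)) + (de + m) * E k (d X k s)
             + m * E k (orth_proj (bdry X k) u))]]].
Proof.
have e0 : k - 1 = k - 1 - 1 + 1 by rewrite subrK.
have e1 : k = k - 1 + 1 by rewrite subrK.
have e2 : k + 1 = k + 1 by [].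
have e3 : k + 1 + 1 = k + 1 + 1 by [].
have [c1 c1_ge0 P1] := poincareV compX e1.
have [c2 c2_ge0 P2] := poincareV compX e2.
have [C0 C0_ge0 K0] := projected_solution_bound compX e0 e1.
have [C1 C1_ge0 K1] := projected_solution_bound compX e1 e2.
have [C2 C2_ge0 K2] := projected_solution_bound compX e2 e3.
have C0L : C0 <= C0 + C1 + C2 by rewrite -addrA lerDl addr_ge0.
have C1L : C1 <= C0 + C1 + C2 by rewrite addrAC lerDr addr_ge0.
have C2L : C2 <= C0 + C1 + C2 by rewrite lerDr addr_ge0.
have [a0 a1 a2] := And3 (c_ge0 (k - 1)) (c_ge0 k) (c_ge0 (k + 1)).
(* [M] dominates the factors [1 + c n] in the three degrees and the discrete Poincare constants in
   degrees k - 1 and k. *)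
pose M := 1 + c (k - 1) + c k + c (k + 1) + c (k - 1) * c1 + c k * c2.
have b1 := mulr_ge0 a0 c1_ge0; have b2 := mulr_ge0 a1 c2_ge0.
have M1 : 1 <= M by rewrite /M; lra.
have M0 : 0 <= M by lra.
(* The first summand bounds eta and delta, the second mu. *)
pose L := M * (C0 + C1 + C2) + M.
have x0 := mulr_ge0 M0 C0_ge0; have x1 := mulr_ge0 M0 C1_ge0.
have x2 := mulr_ge0 M0 C2_ge0.
have le_L (C a : R) n : 1 + c n <= M -> 0 <= C -> C <= C0 + C1 + C2 ->
    a <= (1 + c n) * C -> a <= L.
  move=> nM C_ge0 CC aC; apply: le_trans aC _.
  have := ler_wpM2r C_ge0 nM; have := ler_wpM2l M0 CC; rewrite /L; lra.
have n0 : 1 + c (k - 1) <= M by rewrite /M; lra.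
have n1 : 1 + c k <= M by rewrite /M; lra.
have n2 : 1 + c (k + 1) <= M by rewrite /M; lra.
have n1L : 1 + c k <= L by rewrite /L; lra.
exists M, L; split=> //; first by rewrite /L; lra.
move=> S pi hS hpi bpi E et de m.
have PS1 : poincare S (k - 1) k M.
  by apply: poincareW (poincare_projection hS hpi e1 c1_ge0 a0 P1 (bpi _)); rewrite /M; lra.
have PS2 : poincare S k (k + 1) M.
  by apply: poincareW (poincare_projection hS hpi e2 c2_ge0 a1 P2 (bpi _)); rewrite /M; lra.
have [/andP[? d0] /andP[dK0_ge0 dK0] /andP[? ?] B0] := K0 S pi c hS hpi c_ge0 bpi.
have [/andP[de_ge0 deL] /andP[dK1_ge0 dK1] /andP[ds1_ge0 ds1] B1] := K1 S pi c hS hpi c_ge0 bpi.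
have [/andP[? ?] /andP[? ?] /andP[ds2_ge0 ds2] B2] := K2 S pi c hS hpi c_ge0 bpi.
have [/andP[m_ge0 mL] Bm] := projected_harmonic_bound compX e1 e2 hS hpi c_ge0 bpi.
have et_ge0 : 0 <= et by rewrite /et /eta !le_max dK1_ge0.
have etL : et <= L.
  rewrite /et /eta !ge_max; apply/andP; split; apply/andP; split.
  - exact: (le_L C1 _ _ n2).
  - exact: (le_L C1 _ _ n0).
  - exact: (le_L C0 _ _ n1).
  - exact: (le_L C2 _ _ n1).
have apx n (x : X n) : 1 + c n <= M -> V X n x -> `|x - pi n x| <= M * E n x.
  move=> nM Vx; apply: le_trans (projection_best_approx hS hpi c_ge0 bpi Vx) _.
  by rewrite ler_wpM2r // best_approx_ge0 //; case: hS.
have et1 (a b : R) : 0 <= b -> a <= norm_dstarK pi (k - 1) k * b -> a <= et * b.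
  move=> b0 ab; apply: le_trans ab _; rewrite ler_wpM2r // /et /eta !le_max lexx ?orbT //.
have et2 (a b : R) : 0 <= b -> a <= norm_dK pi (k - 1) k * b -> a <= et * b.
  move=> b0 ab; apply: le_trans ab _; rewrite ler_wpM2r // /et /eta !le_max lexx ?orbT //.
have et3 (a b : R) : 0 <= b -> a <= norm_dstarK pi k (k + 1) * b -> a <= et * b.
  move=> b0 ab; apply: le_trans ab _; rewrite ler_wpM2r // /et /eta !le_max lexx ?orbT //.
have dual1 y : V X (k - 1) y -> orthogonal_to (cycles (V X) (k - 1) k) y ->
  exists r, [/\ boundaries (V X) (k - 1) k r,
    forall t, V X (k - 1) t -> <|r, d X k t|> = <|y, t|>,
    `|r - pi k r| <= de * `|d X k y|, `|r - pi k r| <= et * `|y| &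
    `|y - pi (k - 1) y| <= et * `|d X k y|].
  (* [sol1], in degree k, gives the bounds by delta and by the adjoint part of eta; [sol0], in
     degree k - 1, gives the one by its [d K] part. *)
  move=> Vy yZ; have [r [q [Br dq hr sol1 /(_ _ e0) sol0]]] := dual_potential compX e1 e2 Vy yZ.
  have [h1 _ h3] := B1 _ _ _ _ sol1; have [_ h2 _] := B0 _ _ _ _ sol0.
  rewrite dq in h2; exists r; split=> //; [exact: et2|exact: et1].
have dual2 y : V X k y -> orthogonal_to (cycles (V X) k (k + 1)) y ->
    `|y - pi k y| <= et * `|d X (k + 1) y|.
  move=> Vy yZ; have [r [q [Br dq hr sol1 _]]] := dual_potential compX e2 e3 Vy yZ.
  by have [_ _ h3] := B2 _ _ _ _ sol1; exact: et3.
split=> //.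
  split; apply/andP; split=> //; first exact: (le_L C1 _ _ n1).
  exact: le_trans mL n1L.
move=> g s u p s' u' p' sol sol'.
have Bsub := boundaries_subspace (subcomplexV X) e1.
have [w Bw uw] := orthogonal_decomposition Bsub
  (boundaries_closed (subcomplexV X) e1 c1_ge0 P1) u.
have -> : orth_proj (bdry X k) u = w by exact: (orth_projE Bsub Bw uw).
split.
- exact: (boundary_error hS hpi e1 e2 (fun x => apx k x n1) sol sol').
- exact: (stress_error hS hpi e1 e2 M1 et_ge0 (fun x => apx _ x n0)
    (fun x => apx k x n1) dual1 sol sol').
- exact: (total_error hS hpi e1 e2 M1 et_ge0 de_ge0 m_ge0 PS1 PS2 c1_ge0 P1
    (fun x => apx _ x n0) (fun x => apx k x n1) (fun x => apx _ x n2)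
    dual1 dual2 Bm sol sol' etL Bw uw).
Qed.

End Discretization.

(** The comparison adds all of [Q] to each linear bound. The terms of [Q] missing from a right-hand
    side are multiples of [eds] or [es], which that side contains, by at most three coefficients
    bounded by [L]; hence the factor [1 + 3 * L]. *)
Lemma absorb_coefficients {R : realFieldType} (M L C et de m es eds eu edu ep ew : R) :
  0 <= M -> 0 <= L -> 0 <= C -> 0 <= et <= L -> 0 <= de <= L -> 0 <= m <= L ->
  0 <= es -> 0 <= eds -> 0 <= eu -> 0 <= edu -> 0 <= ep -> 0 <= ew ->
  let Q := eu + edu + ep + et * (es + eds) + (de + m) * eds + m * ew in
  let N := (1 + 3 * L) * (6 * M + C) in
  [/\ M * eds + C * Q <= N * (eds + eu + edu + ep + et * es + m * ew),
      6 * M * (es + et * eds) + C * Q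
        <= N * (es + eu + edu + ep + (et + de + m) * eds + m * ew) &
      C * Q <= N * Q].
Proof.
move=> M0 L0 C0 /andP[et0 etL] /andP[de0 deL] /andP[m0 mL] es0 eds0 eu0 edu0 ep0 ew0 Q N.
have key a B r : 0 <= r -> a <= 6 * M * B + C * Q -> B <= r -> Q <= r + 3 * (L * r) ->
    a <= N * r.
  move=> r0 aB Br Qr; have M6 : 0 <= 6 * M by rewrite mulr_ge0.
  have := ler_wpM2l M6 Br; have := ler_wpM2l C0 Qr.
  have := mulr_ge0 M6 (mulr_ge0 L0 r0); rewrite /N; lra.
have y1 := mulr_ge0 et0 es0; have y2 := mulr_ge0 et0 eds0; have y3 := mulr_ge0 de0 eds0.
have y4 := mulr_ge0 m0 eds0; have y5 := mulr_ge0 m0 ew0; have z1 := mulr_ge0 M0 eds0.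
have l1 := ler_wpM2r es0 etL; have l2 := ler_wpM2r eds0 etL.
have l3 := ler_wpM2r eds0 deL; have l4 := ler_wpM2r eds0 mL.
split.
- set r := (X in _ <= _ * X); have er : eds <= r by rewrite /r; lra.
  have := ler_wpM2l L0 er => h; apply: (key _ eds); [|lra|lra|].
    by rewrite /r; lra.
  by apply: (@le_trans _ _ (r + 3 * (L * eds))); [rewrite /Q /r|]; lra.
- set r := (X in _ <= _ * X); have er : es <= r by rewrite /r; lra.
  have r0 : 0 <= r by rewrite /r; lra.
  have := ler_wpM2l L0 er => h; have h0 := mulr_ge0 L0 r0.
  apply: (key _ (es + et * eds)) => //; first by rewrite /r; lra.
  by apply: (@le_trans _ _ (r + L * es)); [rewrite /Q /r|]; lra.
- have Q0 : 0 <= Q by rewrite /Q; lra.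
  apply: (key _ 0) => //; first by rewrite mulr0 add0r.
  by rewrite lerDl !mulr_ge0.
Qed.

Theorem theorem4p2 (R : realType) (X : hilbert_complex R)
  (closedX : closed_complex X) (compactX : compactness_property X)
  (Idx : Type) (Vh : Idx -> forall j : int, set (X j))
  (pi : Idx -> forall j : int, X j -> X j)
  (subVh : forall h, subcomplex (Vh h))
  (projpi : forall h, cochain_projection (Vh h) (pi h))
  (boundpi : uniformly_W_bounded pi)
  (k : int) (F : X k -> X k) (monoF : monotone_op F) (lipF : V_lipschitz F) :
  exists C : R, forall (f : X k) (s : X (k - 1)) (u p : X k),
    semilinear_solution (V X) F f s u p ->
    forall (h : Idx) (sh : X (k - 1)) (uh ph : X k),
    semilinear_solution (Vh h) F f sh uh ph ->
    let E := fun (j : int) (w : X j) => best_approx (Vh h j) w in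
    let ds := d X k s in
    let du := d X (k + 1) u in
    let PBu := orth_proj (bdry X k) u in
    let de := delta (pi h) k in
    let m := mu (pi h) k in
    let et := eta (pi h) k in
    [/\ `|d X k (s - sh)| <=
          C * (E k ds + E k u + E (k + 1) du + E k p
               + et * E (k - 1) s + m * E k PBu),
        `|s - sh| <=
          C * (E (k - 1) s + E k u + E (k + 1) du + E k p
               + (et + de + m) * E k ds + m * E k PBu) &
        normV (u - uh) + `|p - ph| <=
          C * (E k u + E (k + 1) du + E k p + et * (E (k - 1) s + E k ds)
               + (de + m) * E k ds + m * E k PBu)].
Proof.
have [CF0 lipF0] := lipF; pose CF := `|CF0|.
have lip u v : V X k u -> V X k v -> `|F u - F v| <= CF * normV (u - v).
  move=> Vu Vv; apply: le_trans (lipF0 _ _ Vu Vv) _.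
  by rewrite ler_wpM2r ?sqrtr_ge0 // ler_norm.
have /boolp.choice[c hc] : forall j : int, exists c : R, forall h x,
    V X j x -> `|pi h j x| <= c * `|x| by exact: boundpi.
(* Absolute values, as the chosen bounds [c n] carry no sign. *)
have [M [L [M1 L0 est]]] := linear_estimates compactX k (fun n => normr_ge0 (c n)).
pose C3 := 15 * M + 6 * M * L + 7 * M ^+ 2 + 3 * M ^+ 3.
pose C4 := 3 * (M + 1) ^+ 2 * CF.
have e1 : k = k - 1 + 1 by rewrite subrK.
have M0 : 0 <= M by lra.
have CF_ge0 : 0 <= CF by exact: normr_ge0.
have C3_ge0 : 0 <= C3 by rewrite /C3 !addr_ge0 ?mulr_ge0 ?exprn_ge0.
have C4_ge0 : 0 <= C4 by rewrite /C4 !mulr_ge0 ?exprn_ge0 ?addr_ge0.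
(* The factor [1 + CF] lets [C5 * Q] dominate both [Y + Z] and [CF * (Y + Z)], where
   [Z = C4 * Y]. *)
pose C5 := (1 + CF) * (1 + C4) * C3.
exists ((1 + 3 * L) * (6 * M + C5)) => f s u p sol h sh uh ph solh E ds du PBu de m et.
have [|PS1 PS2 [/andP[et0 etL] /andP[de0 deL] /andP[m0 mL]] lin] :=
  est _ _ (subVh h) (projpi h).
  move=> n x Vx; apply: le_trans (hc n h x Vx) _.
  by rewrite ler_wpM2r // ler_norm.
have [s' [u' [p' sol']]] := mixed_solution_exists (subVh h) (f - F (u + p)) e1 erefl
  M0 M0 PS1 PS2.
have msol := semilinear_mixed_solution sol.
have msolh := semilinear_mixed_solution solh.
have [hD hT hY] := lin _ _ _ _ _ _ _ msol sol'.
have [[Vs Vu [Vp dp _]] _] := msol.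
have [hZ hB] := semilinear_comparison e1 erefl CF_ge0 monoF lip (subVh h) M0 PS1 PS2
  Vu Vp dp sol' msolh.
have subS n : linear_subspace (Vh h n) by case: (subVh h).
have E_ge0 n (x : X n) : 0 <= E n x by exact: best_approx_ge0.
have [[Ssh Suh _] _] := msolh.
have [_ SV _ _] := subVh h.
have Vsh := SV _ _ Ssh; have Vuh := SV _ _ Suh.
have hds : `|d X k (s - sh)| <= `|d X k s - d X k s'| + `|d X k s' - d X k sh|.
  rewrite (linear_onB (V_subspace R X _) (d_linear R X _ _ e1)) //; exact: ler_distD.
have hs : `|s - sh| <= `|s - s'| + `|s' - sh| by exact: ler_distD.
have hp : `|p - ph| <= `|p - p'| + `|p' - ph| by exact: ler_distD.
have hu : normV (u - uh) <= (`|u - u'| + `|u' - uh|)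
    + (`|d X (k + 1) u - d X (k + 1) u'| + `|d X (k + 1) u' - d X (k + 1) uh|).
  apply: le_trans (sqrt_sqrD_le _ _) _ => //.
  by rewrite (linear_onB (V_subspace R X _) (d_linear R X _ _ erefl)) // lerD // ler_distD.
set Q := E k u + _ + _ + _ + _ + _ in hY *.
set Y := `|u - u'| + _ + _ in hY hZ hB.
set Z := 3 * _ * _ in hZ hB.
have Y0 : 0 <= Y by rewrite /Y !addr_ge0.
have YQ : Y + Z <= (1 + C4) * C3 * Q.
  have -> : Y + Z = (1 + C4) * Y by rewrite /Z /C4; ring.
  by rewrite -mulrA ler_wpM2l // addr_ge0.
have Q0 : 0 <= Q.
  by rewrite /Q !addr_ge0 // mulr_ge0 // addr_ge0.
have W0 : 0 <= (1 + C4) * C3 * Q by rewrite !mulr_ge0 // addr_ge0.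
have WC : (1 + CF) * ((1 + C4) * C3 * Q) = C5 * Q by rewrite /C5; ring.
have C5_ge0 : 0 <= C5 by rewrite /C5 !mulr_ge0 // addr_ge0.
have YZ : Y + Z <= C5 * Q by rewrite -WC; have := mulr_ge0 CF_ge0 W0; lra.
have CYZ : CF * (Y + Z) <= C5 * Q by rewrite -WC; have := ler_wpM2l CF_ge0 YQ; lra.
have [r1 r2 r3] := absorb_coefficients M0 L0 C5_ge0 (introT andP (conj et0 etL))
  (introT andP (conj de0 deL)) (introT andP (conj m0 mL)) (E_ge0 _ s) (E_ge0 _ ds)
  (E_ge0 _ u) (E_ge0 _ du) (E_ge0 _ p) (E_ge0 _ PBu).
split.
- apply: le_trans r1; apply: le_trans hds _.
  by apply: lerD => //; apply: le_trans hB _.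
- apply: le_trans r2; apply: le_trans hs _; apply: lerD => //; apply: le_trans YZ.
  apply: le_trans (_ : Z <= _); last by rewrite lerDr.
  by apply: le_trans hZ; rewrite -!addrA lerDl !addr_ge0.
- apply: le_trans r3; apply: le_trans YZ.
  apply: (@le_trans _ _ (Y + (`|s' - sh| + `|d X (k + 1) u' - d X (k + 1) uh|
    + `|u' - uh| + `|p' - ph|))); last by rewrite lerD2l.
  by have := normr_ge0 (s' - sh); move: hu hp; rewrite /Y; clear; lra.
Qed.
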